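(* Let $\nu,\mu_0\in\mathcal P_2(\mathbb R)$, and let $R_\nu^{\pm}$ denote either one of the two functions $R_\nu^+$, $R_\nu^-$. For each continuity point $s\in(0,1)$ of $Q_\nu$ define $$g_s(t) := \begin{cases} \Phi_{\nu,s}^{-1}(2t), & t<T_s,\\ Q_\nu(s), & \text{otherwise},\end{cases}\qquad t\ge 0,$$ where $T_s := \frac12 \Phi_{\nu,s}(Q_\nu(s))$ and $\Phi_{\nu,s}(x) := \int_{Q_{\mu_0}(s)}^{x} (s-R_\nu^{\pm}(z))^{-1}\,dz$ for $x\in[\min\{Q_{\mu_0}(s),Q_\nu(s)\},\max\{Q_{\mu_0}(s),Q_\nu(s)\}]$. Then, via $[g(t)](s) := g_s(t)$, the family $\{g_s : s\in(0,1) \text{ is a continuity point of } Q_\nu\}$ is a strong solution of the Cauchy problem $$\partial_t g(t) \in -\partial F_\nu(g(t)),\quad t\in(0,\infty),\qquad g(0)=Q_{\mu_0},$$ in $L_2(0,1)$, where $F_\nu(u) = \int_0^1 \big( (1-2s)\,u(s) + \int_0^1 |u(s)-Q_\nu(t)|\,dt \big) ds$ for $u\in L_2(0,1)$.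
   Context: $\mathcal P_2(\mathbb R)$ is the set of Borel probability measures on $\mathbb R$ with finite second moment. For a probability measure $\mu$ on $\mathbb R$: $R_\mu^+(x) := \mu((-\infty,x])$, $R_\mu^-(x) := \mu((-\infty,x))$ and $Q_\mu(s) := \min\{x \in \mathbb R : R_\mu^+(x) \ge s\}$, $s\in(0,1)$. All but countably many $s\in(0,1)$ are continuity points of $Q_\nu$, so $g(t)$ is defined a.e. on $(0,1)$. The values $\Phi_{\nu,s}(Q_\nu(s))$ and $T_s$ may be $+\infty$. The subdifferential is $\partial F(u) := \{ v \in L_2(0,1) : F(w) \ge F(u) + \langle v, w-u\rangle + o(\|w-u\|) \text{ for all } w \in L_2(0,1)\}$ (for convex $F$ the $o$-term can be omitted). A strong solution of the Cauchy problem is a function $g \colon [0,\infty)\to L_2(0,1)$ with $g \in W^1_1((0,T];L_2(0,1)) \cap C([0,\infty);L_2(0,1))$ for every $T>0$, satisfying the initial condition and, for a.e. $t>0$, the inclusion, where $\partial_t g(t)$ is the strong derivative. *)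

(* Defs.v *)
From HB Require Import structures.
From mathcomp Require Import all_boot all_order all_algebra.
From mathcomp Require Import all_classical all_reals all_analysis.

Set Implicit Arguments.
Unset Strict Implicit.
Unset Printing Implicit Defensive.

Import Order.TTheory GRing.Theory Num.Theory.
Import numFieldNormedType.Exports.

Local Open Scope classical_set_scope.
Local Open Scope ring_scope.

(* Elements of L_2(0,1) are represented by Borel functions R -> R, of which
   only the restriction to ]0, 1[ matters; every notion below is unchanged when
   a function is replaced by another Borel representative. *)

Section L2_unit_interval.
Context {R : realType}.

Definition leb01 : {measure set (measurableTypeR R) -> \bar R} :=
  mrestr (@lebesgue_measure R) (measurable_itv `]0, 1[).

Definition L2 : set (R -> R) := [set u | u \in Lfun leb01 2%:E].

Definition normL2 (u : R -> R) : R := fine 'N[leb01]_(2%:E)[EFin \o u].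

Definition innerL2 (u v : R -> R) : R := \int[leb01]_s (u s * v s).

(* Frechet subdifferential; the remainder o(||w - u||) is spelled out. *)
Definition subdifferential (F : (R -> R) -> R) (u : R -> R) : set (R -> R) :=
  [set v | L2 v /\
    forall e : R, 0 < e -> exists2 d : R, 0 < d &
      forall w, L2 w -> normL2 (w - u) < d ->
        F u + innerL2 v (w - u) - e * normL2 (w - u) <= F w].

End L2_unit_interval.

Section Bochner.
Context {R : realType}.

(* The simple function t |-> \sum_i 1_{A i}(t) c i and its integral over D. *)
Definition simpleL2 n (A : 'I_n -> set R) (c : 'I_n -> R -> R) (t : R)
  : R -> R := \sum_(i < n) (\1_(A i) t : R) *: c i.

Definition simpleL2_integral (D : set R) n (A : 'I_n -> set R)
    (c : 'I_n -> R -> R) : R -> R :=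
  \sum_(i < n) fine (@lebesgue_measure R (D `&` A i)) *: c i.

(* For D of finite Lebesgue measure: v is Bochner integrable over D, with
   integral J. The a.e. convergence is the strong measurability of v. *)
Definition is_bochner_integral (D : set R) (v : R -> R -> R) (J : R -> R) :=
  [/\ forall t, D t -> L2 (v t), L2 J &
    exists (n : nat -> nat) (A : forall k, 'I_(n k) -> set R)
           (c : forall k, 'I_(n k) -> R -> R),
    [/\ forall k i, measurable (A k i : set (measurableTypeR R))
                    /\ L2 (c k i),
        {ae @lebesgue_measure R, forall t, D t ->
           normL2 (v t - simpleL2 (A k) (c k) t) @[k --> \oo] --> (0 : R)},
        (\int[@lebesgue_measure R]_(t in D)
           (normL2 (v t - simpleL2 (A k) (c k) t))%:E)%E @[k --> \oo]
          --> 0%E &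
        normL2 (J - simpleL2_integral D (A k) (c k)) @[k --> \oo]
          --> (0 : R)]].

Definition bochner_integrable (D : set R) (v : R -> R -> R) :=
  exists J, is_bochner_integral D v J.

Definition test_function (T : R) (phi : R -> R) :=
  (forall (k : nat) (t : R), derivable (derive1n k phi) t 1) /\
  exists a b : R, [/\ 0 < a, b < T & forall t, phi t != 0 -> a <= t <= b].

Definition weak_derivative (T : R) (g v : R -> R -> R) :=
  forall phi, test_function T phi -> exists2 J : R -> R,
    is_bochner_integral `]0, T[ (fun t => derive1 phi t *: g t) J &
    is_bochner_integral `]0, T[ (fun t => phi t *: v t) (- J).

(* The class W^1_1((0, T]; L_2(0, 1)); the endpoint T is immaterial. *)
Definition W11 (T : R) (g : R -> R -> R) :=
  bochner_integrable `]0, T[ g /\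
  exists2 v, bochner_integrable `]0, T[ v & weak_derivative T g v.

Definition continuousL2 (g : R -> R -> R) :=
  (forall t : R, 0 <= t -> L2 (g t)) /\
  forall t : R, 0 <= t ->
    normL2 (g r - g t) @[r --> within `[0, +oo[ (nbhs t)] --> (0 : R).

Definition strong_derivative (g : R -> R -> R) (t : R) (d : R -> R) :=
  L2 d /\ normL2 (h^-1 *: (g (t + h) - g t) - d) @[h --> 0^'] --> (0 : R).

Definition strong_solution (F : (R -> R) -> R) (g0 : R -> R)
    (g : R -> R -> R) :=
  [/\ forall T : R, 0 < T -> W11 T g,
      continuousL2 g,
      {ae leb01, forall s, g 0 s = g0 s} &
      {ae @lebesgue_measure R, forall t : R, 0 < t ->
        exists2 d, strong_derivative g t d & subdifferential F (g t) (- d)}].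

End Bochner.

Section Flow.
Context {R : realType}.
Implicit Types mu nu : probability (measurableTypeR R) R.

Definition finite_second_moment mu := (\int[mu]_x (x ^+ 2)%:E < +oo)%E.

Definition Rplus mu (x : R) : R := fine (mu `]-oo, x]%classic).
Definition Rminus mu (x : R) : R := fine (mu `]-oo, x[%classic).

(* The least element of A, with junk value 0 if there is none. *)
Definition minimum (A : set R) : R := xget 0 (A `&` lbound A).

Definition quantile mu (s : R) : R := minimum [set x | s <= Rplus mu x].

Definition quantile_continuity_points nu : set R :=
  [set s | 0 < s < 1 /\ {for s, continuous (quantile nu)}].

Definition F_ nu (u : R -> R) : R :=
  \int[leb01]_s ((1 - 2 * s) * u s + \int[leb01]_t `|u s - quantile nu t|).

(* In the next three definitions Rnu stands for Rplus nu or Rminus nu. *)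

(* Oriented integral from [quantile mu0 s] to x, with values in \bar R. *)
Definition Phi mu0 (Rnu : R -> R) (s x : R) : \bar R :=
  let a := quantile mu0 s in
  if a <= x
  then (\int[@lebesgue_measure R]_(z in `[a, x]) ((s - Rnu z)^-1)%:E)%E
  else (- \int[@lebesgue_measure R]_(z in `[x, a]) ((s - Rnu z)^-1)%:E)%E.

Definition Phi_dom mu0 nu (s : R) : set R :=
  `[Num.min (quantile mu0 s) (quantile nu s),
    Num.max (quantile mu0 s) (quantile nu s)].

Definition hitting_time mu0 nu (Rnu : R -> R) (s : R) : \bar R :=
  ((2^-1)%:E * Phi mu0 Rnu s (quantile nu s))%E.

Definition flow_at mu0 nu (Rnu : R -> R) (s t : R) : R :=
  if (t%:E < hitting_time mu0 nu Rnu s)%E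
  then 'pinv_(fun=> 0) (Phi_dom mu0 nu s) (Phi mu0 Rnu s) (2 * t)%:E
  else quantile nu s.

(* [g(t)](s) := g_s(t); the value on the null set of the s where Q_nu is not
   continuous is irrelevant and is set to 0. *)
Definition flow mu0 nu (Rnu : R -> R) (t : R) : R -> R :=
  (fun s => flow_at mu0 nu Rnu s t) \_ (quantile_continuity_points nu).

End Flow.

(* Main.v *)
Require Import Defs.
From HB Require Import structures.
From mathcomp Require Import all_boot all_order all_algebra.
From mathcomp Require Import all_classical all_reals all_analysis.
From mathcomp Require Import measurable_realfun ring lra.

Set Implicit Arguments.
Unset Strict Implicit.
Unset Printing Implicit Defensive.

Import Order.TTheory GRing.Theory Num.Theory.
Import numFieldNormedType.Exports.

Local Open Scope classical_set_scope.
Local Open Scope ring_scope.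

(** The energy splits over the levels: [F_ nu u] is the integral over s of
    f_s (u s), where f_s x = (1 - 2 s) x + \int |x - y| dnu(y) is convex with
    one-sided derivatives 2 (Rminus x - s) and 2 (Rplus x - s).  The inclusion
    therefore decouples into the scalar equations x' = 2 (s - Rnu x), one for
    every level s.  Their right-hand side is nonincreasing and vanishes (or
    jumps over 0) at [quantile nu s]; separation of variables gives the
    solution, which moves from [quantile mu0 s] monotonically towards
    [quantile nu s], reaches a point x at time [Phi x] / 2, and stops when the
    target is reached, if ever.

    The argument has a scalar part and a part in L_2(0,1).

    Scalar part.  Write w for s - Rnu, put equal to 0 at the target.  The speed
    |w| decreases along a trajectory, so that the slope of a trajectory between
    two times lies between 2 w at the two end points ([flow_at_increment]).
    Hence trajectories are 2-Lipschitz, uniformly in s, and have derivative 2 w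
    at every time at which w is continuous at the current position, which can
    fail only when this position is an atom of nu that the trajectory is just
    passing or reaching ([flow_at_derive]).  A higher level moves up faster and
    down slower.  This makes the flow nondecreasing in s ([flow_at_nd]), hence
    measurable, and at a given positive time lets at most two levels pass any
    given point ([countable_atom_passing]).  As nu has countably many atoms, at
    every t > 0 all but countably many trajectories are differentiable at t.

    Part in L_2(0,1).  By the uniform Lipschitz bound and dominated convergence
    the flow is strongly differentiable at every t > 0
    ([curve_strong_derivative]), and its derivative satisfies the inclusion
    because the supporting lines of f_s can be integrated
    ([subdifferential_F_]).  Membership in W^1_1 asks for Bochner integrals.
    For a Lipschitz curve that is strongly differentiable at every time they
    are limits of dyadic sums: the difference quotients of the curve over the
    cells approximate its derivative, and integration by parts against a test
    function is Abel summation of these sums ([curve_W11]). *)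

(** * Square-integrable functions on the unit interval *)

Section L2_tools.
Context {R : realType}.
Implicit Types (u w G : R -> R) (s c : R).

Let I2 u := (\int[@leb01 R]_s ((u s) ^+ 2)%:E)%E.

Let I2_ge0 u : (0 <= I2 u)%E.
Proof. by apply: integral_ge0 => s _; rewrite lee_fin sqr_ge0. Qed.

Lemma leb01_setT : @leb01 R [set: R] = 1%E.
Proof.
rewrite /leb01 /= /mrestr setTI lebesgue_measure_itv/= lte_fin ltr01.
by rewrite oppr0 addr0.
Qed.

Lemma integral01_cst c : (\int[@leb01 R]_s c%:E = c%:E)%E.
Proof.
have := integral_cst (@leb01 R) measurableT c%:E.
by rewrite /cst leb01_setT mule1.
Qed.

Lemma Lnorm2E u :
  ('N[leb01]_(2%:E)[EFin \o u] = (\int[@leb01 R]_s ((u s) ^+ 2)%:E) `^ 2^-1)%E.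
Proof.
rewrite unlock /Lnorm; congr (_ `^ _)%E; apply: eq_integral => s _ /=.
by rewrite -[2]/(2%:R) powR_mulrn// real_normK// num_real.
Qed.

Lemma L2P u : L2 u <-> measurable_fun [set: R] u /\
  (\int[@leb01 R]_s ((u s) ^+ 2)%:E < +oo)%E.
Proof.
rewrite /L2 /=; split.
- rewrite inE => /andP[mu Nu]; split; first by rewrite inE in mu.
  move: Nu; rewrite inE/= /finite_norm Lnorm2E => /lty_poweRy; apply.
  by rewrite invr_eq0.
- move=> [mu Iu]; rewrite inE; apply/andP; split; first by rewrite inE.
  by rewrite inE/= /finite_norm Lnorm2E poweR_lty.
Qed.

Lemma L2_measurable u : L2 u -> measurable_fun [set: R] u.
Proof. by case/L2P. Qed.

Lemma normL2_sqrt u : L2 u ->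
  normL2 u = Num.sqrt (fine (\int[@leb01 R]_s ((u s) ^+ 2)%:E)%E).
Proof.
move=> /L2P[_ Iu]; rewrite /normL2 Lnorm2E.
move: (I2_ge0 u); rewrite -/(I2 u) in Iu *.
by case: (I2 u) Iu => // r _ /=; rewrite lee_fin => /powR12_sqrt ->.
Qed.

Lemma normL2_ge0 u : 0 <= normL2 u.
Proof. exact/fine_ge0/Lnorm_ge0. Qed.

Let meas_sqr u : measurable_fun [set: R] u ->
  measurable_fun [set: R] (EFin \o (fun s => (u s) ^+ 2)).
Proof. by move=> mu; apply/measurable_EFinP; exact: measurable_funX. Qed.

Let I2_dom u G : measurable_fun [set: R] u -> measurable_fun [set: R] G ->
  (forall s, `|u s| <= `|G s|) -> (I2 u <= I2 G)%E.
Proof.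
move=> mu mG uG; apply: ge0_le_integral => //.
- by move=> s _; rewrite lee_fin sqr_ge0.
- exact: meas_sqr.
- exact: meas_sqr.
- move=> s _; rewrite lee_fin -[leLHS]real_normK ?num_real//.
  by rewrite -[leRHS]real_normK ?num_real// lerXn2r// nnegrE.
Qed.

Lemma L2_dom u G : measurable_fun [set: R] u -> L2 G ->
  (forall s, `|u s| <= `|G s|) -> L2 u.
Proof.
move=> mu /L2P[mG IG] uG; apply/L2P; split => //.
by apply: le_lt_trans IG; exact: I2_dom.
Qed.

Lemma normL2_dom u G : measurable_fun [set: R] u -> L2 G ->
  (forall s, `|u s| <= `|G s|) -> normL2 u <= normL2 G.
Proof.
move=> mu LG uG; have Lu := L2_dom mu LG uG.
rewrite !normL2_sqrt//; apply: ler_wsqrtr; apply: fine_le.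
- by rewrite ge0_fin_numE; [case/L2P: Lu|exact: I2_ge0].
- by rewrite ge0_fin_numE; [case/L2P: LG|exact: I2_ge0].
- by apply: I2_dom => //; exact: L2_measurable.
Qed.

Lemma L2_cst c : L2 (cst c : R -> R).
Proof.
apply/L2P; split; first exact: measurable_cst.
by rewrite (_ : (\int[_]_s _)%E = (c ^+ 2)%:E) ?ltry// -[RHS]integral01_cst.
Qed.

Lemma L2_abs u : L2 u -> L2 (fun s => `|u s|).
Proof.
move=> Lu; have mu := L2_measurable Lu.
apply: (L2_dom (measurableT_comp (@normr_measurable R setT) mu) Lu) => s /=.
by rewrite normr_id.
Qed.

Lemma L2_bounded u c : measurable_fun [set: R] u -> (forall s, `|u s| <= c) ->
  L2 u.
Proof.
move=> mu uc; apply: (L2_dom mu (L2_cst c)) => s /=.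
by rewrite (le_trans (uc s))// ler_norm.
Qed.

Lemma L2D u w : L2 u -> L2 w -> L2 (u + w).
Proof. by rewrite /L2/= => Lu Lw; apply: (Lfun_addr_closed _ _).2; rewrite ?lee1n. Qed.

Lemma L2N u : L2 u -> L2 (- u).
Proof. by rewrite /L2/= => Lu; apply: Lfun_oppr_closed; rewrite ?lee1n. Qed.

Lemma L2B u w : L2 u -> L2 w -> L2 (u - w).
Proof. by move=> Lu Lw; apply: L2D => //; exact: L2N. Qed.

Lemma L2Z c u : L2 u -> L2 (c *: u).
Proof.
rewrite /L2/= => Lu; have -> : c *: u = c \o* u :> (R -> R).
  by apply/funext => s /=; rewrite mulrC.
by apply: Lfun_scale => //; rewrite ler1n.
Qed.

Lemma L2_sum n (u : 'I_n -> R -> R) : (forall i, L2 (u i)) ->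
  L2 (\sum_(i < n) u i).
Proof.
move=> Lu; apply: (@big_ind _ (fun u => L2 u)) => //.
- exact: (L2_cst 0).
- exact: L2D.
Qed.

Lemma normL2_eqabs u w : (forall s, `|u s| = `|w s|) -> normL2 u = normL2 w.
Proof.
move=> uw; rewrite /normL2 !Lnorm2E; congr (fine (_ `^ _)%E).
apply: eq_integral => s _; congr (_%:E).
by rewrite -[LHS]real_normK ?num_real// uw real_normK ?num_real.
Qed.

Lemma normL2C u w : normL2 (u - w) = normL2 (w - u).
Proof. by apply: normL2_eqabs => s; rewrite !fctE distrC. Qed.

Lemma normL2_cst c : normL2 (cst c : R -> R) = `|c|.
Proof.
rewrite normL2_sqrt; last exact: L2_cst.
by rewrite (_ : (\int[_]_s _)%E = (c ^+ 2)%:E) ?sqrtr_sqr// -[RHS]integral01_cst.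
Qed.

Lemma normL2_bounded u c : measurable_fun [set: R] u -> 0 <= c ->
  (forall s, `|u s| <= c) -> normL2 u <= c.
Proof.
move=> mu c0 uc; rewrite -[leRHS](ger0_norm c0) -normL2_cst.
by apply: normL2_dom => //; [exact: L2_cst|move=> s /=; rewrite (ger0_norm c0)].
Qed.

Lemma normL2D u w : L2 u -> L2 w -> normL2 (u + w) <= normL2 u + normL2 w.
Proof.
move=> Lu Lw; rewrite /normL2.
have fL v : L2 v -> ('N[leb01]_(2%:E)[EFin \o v] \is a fin_num)%E.
  rewrite /L2/= inE => /andP[_]; rewrite inE/= /finite_norm.
  by rewrite ge0_fin_numE// Lnorm_ge0.
rewrite -fineD ?fL// fine_le ?fL//; first exact: L2D.
  by rewrite fin_numD !fL.
apply: minkowski_EFin; rewrite ?ler1n//; exact: L2_measurable.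
Qed.

Lemma normL2B_le u w : L2 u -> L2 w -> `|normL2 u - normL2 w| <= normL2 (u - w).
Proof.
move=> Lu Lw; rewrite ler_norml; apply/andP; split.
- rewrite lerNl opprB lerBlDr normL2C -[in leLHS](subrK u w).
  by apply: normL2D => //; exact: L2B.
- rewrite lerBlDr -[in leLHS](subrK w u).
  by apply: normL2D => //; exact: L2B.
Qed.

(** Dominated convergence for the squares. *)
Lemma normL2_cvg0 (u : nat -> R -> R) G :
  (forall k, measurable_fun [set: R] (u k)) -> L2 G ->
  (forall k s, `|u k s| <= `|G s|) ->
  {ae leb01, forall s, u k s @[k --> \oo] --> (0 : R)} ->
  normL2 (u k) @[k --> \oo] --> (0 : R).
Proof.
move=> mu LG uG u0.
have Lu k : L2 (u k) by apply: L2_dom LG (uG k).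
under eq_cvg => k do rewrite normL2_sqrt//.
suff I0 : (\int[@leb01 R]_s ((u k s) ^+ 2)%:E)%E @[k --> \oo] --> 0%E.
  have := continuous_cvg _ (@sqrt_continuous R (fine 0%E)) (fine_cvg I0).
  rewrite [fine 0%E]/(0 : R) sqrtr0; exact.
have /L2P[mG IG] := LG.
have := @dominated_convergence _ _ R leb01 [set: R] measurableT
  (fun k s => (u k s ^+ 2)%:E) (cst 0%E) (fun s => (G s ^+ 2)%:E).
case.
- by move=> k; exact: meas_sqr.
- exact: measurable_cst.
- apply: (@filterS _ _ (ae_filter_ringOfSetsType leb01) _ _ _ u0) => s us _ /=.
  rewrite -[0%E]/((0 : R)%:E).
  apply: cvg_EFin; first by near=> k.
  rewrite (_ : fine \o _ = (fun k => u k s ^+ 2)); last by apply/funext.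
  rewrite -[X in _ --> X](mulr0 (0 : R))
    (_ : (fun k => _) = (fun k => u k s * u k s)).
    exact: cvgM.
  by apply/funext => k; rewrite expr2.
- apply/integrableP; split; first exact: meas_sqr.
  by under eq_integral => s _ do rewrite gee0_abs ?lee_fin ?sqr_ge0//.
- apply: aeW => s k _; rewrite gee0_abs ?lee_fin ?sqr_ge0//.
  rewrite -[leLHS]real_normK ?num_real// -[leRHS]real_normK ?num_real//.
  by rewrite lerXn2r// nnegrE.
- by rewrite integral0.
Unshelve. all: by end_near. Qed.

End L2_tools.

(** * Bochner integrals from dyadic step functions *)

Section real_sequences.
Context {R : realType}.

(** The sequence a_k - 2 K / 2^k increases and a_k + 2 K / 2^k decreases, so
    that the limit exists and lies between them; this gives the rate as well. *)
Lemma geometric_cvg (a : nat -> R) (K : R) :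
  (forall k, `|a k.+1 - a k| <= K / 2 ^+ k) ->
  exists l, a k @[k --> \oo] --> l /\ forall k, `|a k - l| <= 2 * K / 2 ^+ k.
Proof.
move=> aK; pose e k : R := 2 * K / 2 ^+ k.
have K0 : 0 <= K by have := le_trans (normr_ge0 _) (aK 0%N); rewrite expr0 divr1.
have eS k : e k = e k.+1 + K / 2 ^+ k.
  rewrite /e exprS; have : (2 : R) ^+ k != 0 by rewrite expf_neq0.
  by move=> h; field.
pose b k := a k - e k; pose c k := a k + e k.
have e0 k : 0 <= e k by rewrite /e divr_ge0 ?mulr_ge0// exprn_ge0.
have ndb : nondecreasing_seq b.
  apply/nondecreasing_seqP => k; rewrite /b (eS k).
  have := aK k; rewrite ler_norml => /andP[+ _]; lra.
have nic : nonincreasing_seq c.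
  apply/nonincreasing_seqP => k; rewrite /c (eS k).
  have := aK k; rewrite ler_norml => /andP[_]; lra.
have bc k : b k <= c k by rewrite /b /c; have := e0 k; lra.
have cvgb : cvgn b.
  apply: nondecreasing_is_cvgn => //; exists (c 0%N) => _ [k _ <-].
  by rewrite (le_trans (bc k))// nic.
pose l := limn b.
have bl k : b k <= l by exact: nondecreasing_cvgn_le.
have lc k : l <= c k.
  apply: limr_le => //; near=> m.
  have km : (k <= m)%N by near: m; exists k.
  by rewrite (le_trans (bc m))// nic.
have al k : `|a k - l| <= e k.
  rewrite ler_norml; move: (bl k) (lc k); rewrite /b /c; lra.
exists l; split => //.
have ecvg : e k @[k --> \oo] --> (0 : R).
  rewrite /e -[X in _ --> X](mulr0 (2 * K)); apply: cvgM; first exact: cvg_cst.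
  under eq_cvg do rewrite -exprVn.
  by apply: cvg_expr; rewrite ger0_norm// invf_lt1// ltr1n.
apply/cvgrPdist_le => eps eps0.
move/cvgrPdist_le : ecvg => /(_ _ eps0) [N _ H]; exists N => // k Nk.
rewrite distrC (le_trans (al k))//; have := H k Nk.
by rewrite /= sub0r normrN ger0_norm.
Unshelve. all: by end_near. Qed.

Lemma is_derive_littleo (f : R -> R) (t d : R) : is_derive t 1 f d ->
  forall e, 0 < e -> exists2 del, 0 < del &
    forall h, `|h| < del -> `|f (t + h) - f t - h * d| <= e * `|h|.
Proof.
move=> [df fd] e e0; rewrite -fd.
have /cvgrPdist_le/(_ _ e0)/= := df.
rewrite near_withinE => -[del del0 H]; exists del => //= h hdel.
have [->|h0] := eqVneq h 0; first by rewrite addr0 mul0r subr0 subrr normr0 mulr0.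
have := H h; rewrite /ball_/= sub0r normrN => /(_ hdel h0).
rewrite /derive /= => {}H.
rewrite -(ler_pM2l (_ : 0 < `|h|^-1)) ?invr_gt0 ?normr_gt0//.
rewrite [leRHS]mulrCA mulVf ?normr_eq0// mulr1 -normfV -normrM.
apply: le_trans H; rewrite distrC mulrBr mulKf//.
by rewrite [h *: 1]mulr1 [h + t]addrC lexx.
Qed.

Lemma littleo_is_derive (f : R -> R) (t d : R) :
  (forall e, 0 < e -> exists2 del, 0 < del &
    forall h, `|h| < del -> `|f (t + h) - f t - h * d| <= e * `|h|) ->
  is_derive t 1 f d.
Proof.
move=> H; have cvgd : h^-1 *: ((f \o shift t) (h *: 1) - f t) @[h --> (0 : R)^'] --> d.
  apply/cvgrPdist_le => e e0; have [del del0 {}H] := H _ e0.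
  rewrite near_withinE; exists del => //= h; rewrite /ball_/= sub0r normrN => hdel h0.
  rewrite -(ler_pM2l (_ : 0 < `|h|)) ?normr_gt0// -normrM mulrBr.
  rewrite [h * (_ *: _)]mulrA mulfV// mul1r distrC mulrC [h *: 1]mulr1 [h + t]addrC.
  by rewrite [d * h]mulrC [leRHS]mulrC; exact: H.
by apply: DeriveDef; [apply/cvg_ex; exists d|exact: cvg_lim].
Qed.

(** The slope between two points around t is a convex combination of their
    slopes from t. *)
Lemma is_derive_straddle (f : R -> R) (t d : R) (a b : nat -> R) :
  is_derive t 1 f d -> (forall k, a k < t <= b k) ->
  b k - a k @[k --> \oo] --> (0 : R) ->
  (b k - a k)^-1 * (f (b k) - f (a k)) @[k --> \oo] --> d.
Proof.
move=> fd atb ba0; apply/cvgrPdist_le => e e0.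
have [del del0 fdel] := is_derive_littleo fd e0.
move/cvgrPdist_lt : ba0 => /(_ _ del0) [N _ H]; exists N => // k Nk.
have /andP[ak bk] := atb k; have := H k Nk => /=.
rewrite sub0r normrN => hdel.
have ba : 0 < b k - a k by rewrite subr_gt0 (lt_le_trans ak).
rewrite ger0_norm ?(ltW ba)// in hdel.
have := fdel (b k - t); rewrite [t + _]addrC subrK ger0_norm ?subr_ge0//.
move=> /(_ ltac:(lra)); rewrite ler_norml => /andP[b1 b2].
have := fdel (a k - t); rewrite [t + _]addrC subrK ltr0_norm ?subr_lt0//.
move=> /(_ ltac:(lra)); rewrite ler_norml => /andP[a1 a2].
rewrite distrC -(ler_pM2l ba) -[X in X * `|_|](gtr0_norm ba) -normrM.
rewrite mulrBr mulrA mulfV ?gt_eqF// mul1r ler_norml.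
apply/andP; split; nra.
Qed.
End real_sequences.

Section grid.
Context {R : realType}.
Implicit Types (T t : R) (k i : nat).

(** The subdivisions are dyadic so that each refines the previous one by
    halving its cells. *)
Definition mesh T k : R := T / 2 ^+ k.
Definition grid T k i : R := i%:R * mesh T k.
(** Cells are closed on the right: together they cover ]0, T]. *)
Definition cell T k i : set R := `]grid T k i, grid T k i.+1].

Lemma mesh_gt0 T k : 0 < T -> 0 < mesh T k.
Proof. by move=> T0; rewrite divr_gt0// exprn_gt0. Qed.

Lemma grid0 T k : grid T k 0 = 0.
Proof. by rewrite /grid mul0r. Qed.

Lemma grid_end T k : grid T k (2 ^ k) = T.
Proof. by rewrite /grid /mesh natrX mulrC divfK// expf_neq0. Qed.

Lemma gridS T k i : grid T k i.+1 = grid T k i + mesh T k.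
Proof. by rewrite /grid -addn1 natrD mulrDl mul1r. Qed.

Lemma grid_refine T k i : grid T k.+1 i.*2 = grid T k i.
Proof.
rewrite /grid /mesh -muln2 natrM exprS; have : (2 : R) ^+ k != 0 by rewrite expf_neq0.
by move=> h; field.
Qed.

Lemma grid_ge0 T k i : 0 < T -> 0 <= grid T k i.
Proof. by move=> T0; rewrite mulr_ge0// ltW// mesh_gt0. Qed.

Lemma ler_grid T k i j : 0 < T -> (grid T k i <= grid T k j) = (i <= j)%N.
Proof. by move=> T0; rewrite ler_pM2r ?mesh_gt0// ler_nat. Qed.

Lemma mesh_cvg0 T : mesh T k @[k --> \oo] --> (0 : R).
Proof.
rewrite /mesh -[X in _ --> X](mulr0 T); apply: cvgM; first exact: cvg_cst.
under eq_cvg do rewrite -exprVn.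
by apply: cvg_expr; rewrite ger0_norm// invf_lt1// ltr1n.
Qed.

Lemma cell_exists T t k : 0 < t <= T ->
  exists i : 'I_(2 ^ k), cell T k i t.
Proof.
move=> /andP[t0 tT]; have T0 := lt_le_trans t0 tT.
have ex : exists i, t <= grid T k i.+1.
  by exists (2 ^ k).-1; rewrite prednK ?expn_gt0// grid_end.
case: (ex_minnP ex) => m tm mmin.
have m2k : (m < 2 ^ k)%N.
  have k0 : (0 < 2 ^ k)%N by rewrite expn_gt0.
  have : (m <= (2 ^ k).-1)%N by apply: mmin; rewrite prednK// grid_end.
  by rewrite -ltnS prednK.
exists (Ordinal m2k); rewrite /cell /= in_itv/= tm andbT.
case: m tm mmin {m2k} => [|m] tm mmin; first by rewrite grid0.
by rewrite ltNge; apply/negP => /mmin; rewrite ltnn.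
Qed.

Lemma cell_uniq T t k i j : 0 < T -> cell T k i t -> cell T k j t -> i = j.
Proof.
move=> T0; wlog : i j / (i <= j)%N.
  by move=> H it jt; case/orP: (leq_total i j) => ij; [|apply/esym]; exact: H.
rewrite leq_eqVlt => /predU1P[//|ij]; rewrite /cell /= !in_itv/=.
move=> /andP[_ ti] /andP[jt _].
by have := lt_le_trans jt ti; rewrite ltNge ler_grid// ij.
Qed.

Lemma measurable_cell T k i : measurable (cell T k i : set (measurableTypeR R)).
Proof. exact: measurable_itv. Qed.

Lemma step_eval (V : lmodType R) (x : nat -> V) T k t (i0 : 'I_(2 ^ k)) :
  0 < T -> cell T k i0 t ->
  \sum_(i < 2 ^ k) (\1_(cell T k i) t : R) *: x i = x i0.
Proof.
move=> T0 ti0; rewrite (bigD1 i0)//= indicE mem_set// scale1r big1 ?addr0//.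
move=> i ii0; rewrite indicE memNset ?scale0r// => ti.
by case/eqP: ii0; apply/val_inj; exact: (cell_uniq T0 ti ti0).
Qed.

Lemma lebesgue_cell T k i : 0 < T -> (i < 2 ^ k)%N ->
  fine (@lebesgue_measure R (`]0, T[ `&` cell T k i)) = mesh T k.
Proof.
move=> T0 ik; have m0 := mesh_gt0 k T0.
suff -> : @lebesgue_measure R (`]0, T[ `&` cell T k i) = (mesh T k)%:E by [].
have gT : grid T k i.+1 <= T by rewrite -[leRHS](grid_end T k) ler_grid.
have g0 : 0 <= grid T k i by exact: grid_ge0.
have E b : @lebesgue_measure R [set` Interval (BRight (grid T k i))
    (BSide b (grid T k i.+1))] = (mesh T k)%:E.
  rewrite lebesgue_measure_itv/= lte_fin gridS ltrDl m0 -EFinB.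
  by rewrite addrAC subrr add0r.
(* The last cell loses its end point T, which is a null set. *)
apply/eqP; rewrite eq_le; apply/andP; split.
- rewrite -(E false); apply: le_measure; rewrite ?inE.
  + by apply: measurableI; exact: measurable_itv.
  + exact: measurable_itv.
  + by move=> t [].
- rewrite -(E true); apply: le_measure; rewrite ?inE.
  + exact: measurable_itv.
  + by apply: measurableI; exact: measurable_itv.
  + move=> t; rewrite /cell /= !in_itv/= => /andP[t1 t2]; split.
      by rewrite (le_lt_trans g0 t1) (lt_le_trans t2 gT).
    by rewrite t1 ltW.
Qed.

End grid.

Section bochner_steps.
Context {R : realType}.

Definition step T (c : nat -> nat -> R -> R) k (t : R) : R -> R :=
  simpleL2 (fun i : 'I_(2 ^ k) => cell T k i) (fun i => c k i) t.

Lemma stepE T c k t i : 0 < T -> (i < 2 ^ k)%N -> cell T k i t ->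
  step T c k t = c k i.
Proof.
move=> T0 ik ti; rewrite /step /simpleL2.
exact: (@step_eval _ _ (fun i => c k i) T k t (Ordinal ik)).
Qed.

Lemma measurable_norm_step T (c : nat -> nat -> R -> R) k m : 0 < T ->
  measurable_fun (`]0, T[ : set R)
    (fun t => normL2 (step T c m t - step T c k t)).
Proof.
move=> T0; pose h t : R := \sum_(i < 2 ^ m) (\1_(cell T m i) t : R) *
  \sum_(j < 2 ^ k) (\1_(cell T k j) t : R) * normL2 (c m i - c k j).
apply: (@eq_measurable_fun _ _ _ _ _ h).
  move=> t; rewrite inE/= in_itv/= => /andP[t0 tT].
  have /cell_exists tc : 0 < t <= T by rewrite t0 ltW.
  have [i ti] := tc m; have [j tj] := tc k.
  rewrite (stepE _ T0 (ltn_ord i) ti) (stepE _ T0 (ltn_ord j) tj) /h.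
  rewrite (@step_eval R (R^o : lmodType R)
    (fun i => \sum_(j < 2 ^ k) (\1_(cell T k j) t : R) * normL2 (c m i - c k j))
    T m t i T0 ti).
  by rewrite (@step_eval R (R^o : lmodType R)
    (fun j => normL2 (c m i - c k j)) T k t j T0 tj).
apply: measurable_funTS; apply: measurable_sum => i.
apply: measurable_funM; first exact: measurable_indic (measurable_cell _ _ _).
apply: measurable_sum => j; apply: measurable_funM => //.
exact: measurable_indic (measurable_cell _ _ _).
Qed.

(** The strong measurability of the limit comes for free: the distance from
    the limit to a step function is the limit of distances between two step
    functions, and these take finitely many values. *)
Lemma step_is_bochner_integral T (u : R -> R -> R) (J : R -> R)
    (c : nat -> nat -> R -> R) (M : R) :
  0 < T -> (forall t, 0 < t < T -> L2 (u t)) -> L2 J ->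
  (forall k i, L2 (c k i)) ->
  (forall t k i, 0 < t < T -> cell T k i t -> normL2 (u t - c k i) <= M) ->
  (forall t (i : nat -> nat), 0 < t < T -> (forall k, cell T k (i k) t) ->
    normL2 (u t - c k (i k)) @[k --> \oo] --> (0 : R)) ->
  normL2 (J - \sum_(i < 2 ^ k) mesh T k *: c k i) @[k --> \oo] --> (0 : R) ->
  is_bochner_integral `]0, T[ u J.
Proof.
move=> T0 Lu LJ Lc uM uc cJ.
have dom t : `]0, T[%classic t -> 0 < t < T by rewrite /= in_itv.
have pick t : 0 < t < T -> exists i : nat -> nat,
    forall k, cell T k (i k) t /\ (i k < 2 ^ k)%N.
  move=> /andP[t0 tT]; have tT' : 0 < t <= T by rewrite t0 ltW.
  have /choice[i ti] k : exists i : nat, cell T k i t /\ (i < 2 ^ k)%N.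
    by have [i ti] := cell_exists k tT'; exists i; split.
  by exists i.
have Ls k t : 0 < t < T -> L2 (step T c k t).
  by move=> /pick[i ti]; have [tik ik] := ti k; rewrite (stepE _ T0 ik tik).
have us0 t : 0 < t < T ->
    normL2 (u t - step T c k t) @[k --> \oo] --> (0 : R).
  move=> tT; have [i ti] := pick _ tT.
  rewrite (_ : (fun k => _) = (fun k => normL2 (u t - c k (i k)))).
    by apply: uc => // k; case: (ti k).
  by apply/funext => k; have [tik ik] := ti k; rewrite (stepE _ T0 ik tik).
have usM k t : 0 < t < T -> normL2 (u t - step T c k t) <= M.
  move=> tT; have [i ti] := pick _ tT.
  by have [tik ik] := ti k; rewrite (stepE _ T0 ik tik); exact: uM.
have mus k : measurable_fun (`]0, T[ : set R)
    (fun t => normL2 (u t - step T c k t)).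
  apply: (@measurable_fun_cvg _ _ _ _
    (fun m t => normL2 (step T c m t - step T c k t))).
    by move=> m; exact: measurable_norm_step.
  move=> t /dom tT; apply/cvgrPdist_le => e e0.
  move/cvgrPdist_le : (us0 _ tT) => /(_ _ e0) [N _ H]; exists N => // m Nm.
  have := H m Nm; rewrite /= sub0r normrN ger0_norm ?normL2_ge0//.
  apply: le_trans; apply: le_trans (normL2B_le _ _) _.
  - by apply: L2B; [exact: Lu|exact: Ls].
  - by apply: L2B; exact: Ls.
  - by rewrite opprB addrA subrK.
split => //.
exists (fun k => (2 ^ k)%N), (fun k i => cell T k i), (fun k i => c k i); split.
- by move=> k i; split; [exact: measurable_cell|exact: Lc].
- by apply: aeW => t /dom; exact: us0.
- have mD : measurable (`]0, T[%classic : set (measurableTypeR R)).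
    exact: measurable_itv.
  have := @dominated_convergence _ _ R (@lebesgue_measure R) _ mD
    (fun k t => (normL2 (u t - step T c k t))%:E) (cst 0%E) (cst M%:E).
  case.
  + by move=> k; apply/measurable_EFinP; exact: mus.
  + exact: measurable_cst.
  + apply: aeW => t /dom tT; apply: cvg_EFin; first by near=> k.
    exact: us0.
  + apply/integrableP; split; first exact: measurable_cst.
    rewrite integral_cst//= lebesgue_measure_itv/= lte_fin T0 -EFinD.
    by rewrite -EFinM ltry.
  + apply: aeW => t k /dom tT; rewrite gee0_abs ?lee_fin ?normL2_ge0//.
    exact: usM.
  + by move=> _ _; rewrite integral0.
- rewrite (_ : (fun k => _) =
      (fun k => normL2 (J - \sum_(i < 2 ^ k) mesh T k *: c k i))) //.
  apply/funext => k; congr (normL2 (_ - _)); rewrite /simpleL2_integral.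
  by apply: eq_bigr => i _; rewrite lebesgue_cell.
Unshelve. all: by end_near. Qed.

End bochner_steps.

(** * Lipschitz curves in L_2(0,1) that are differentiable at every time *)

Lemma sum_pairs (V : zmodType) (f : nat -> V) n :
  \sum_(i < n.*2) f i = \sum_(i < n) (f i.*2 + f i.*2.+1).
Proof.
elim: n => [|n IHn]; first by rewrite !big_ord0.
by rewrite doubleS !big_ord_recr/= IHn addrA.
Qed.

Lemma measurable_scale (R : realType) (c : R) (f : R -> R) :
  measurable_fun [set: R] f -> measurable_fun [set: R] (c *: f).
Proof. by move=> mf; exact: (measurable_funM (measurable_cst c) mf). Qed.

Section lipschitz_curve.
Context {R : realType}.
Variables (L : R) (g v : R -> R -> R) (G : R -> R).
Hypothesis L0 : 0 <= L.
Hypothesis mg : forall t : R, 0 <= t -> measurable_fun [set: R] (g t).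
Hypothesis LG : L2 G.
Hypothesis gG : forall t s : R, 0 <= t -> `|g t s| <= G s.
Hypothesis gL : forall t t' s : R, 0 <= t -> 0 <= t' ->
  `|g t s - g t' s| <= L * `|t - t'|.
Hypothesis mv : forall t : R, 0 < t -> measurable_fun [set: R] (v t).
Hypothesis vL : forall t s : R, 0 < t -> `|v t s| <= L.
Hypothesis gv : forall t : R, 0 < t ->
  {ae leb01, forall s, is_derive t 1 (fun r => g r s) (v t s)}.

Let G0 s : 0 <= G s.
Proof. exact: le_trans (gG s (lexx 0)). Qed.

Lemma curve_L2 t : 0 <= t -> L2 (g t).
Proof.
move=> t0; apply: L2_dom (mg t0) LG _ => s.
by rewrite [leRHS]ger0_norm// gG.
Qed.

Lemma velocity_L2 t : 0 < t -> L2 (v t).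
Proof. by move=> t0; apply: (L2_bounded (mv t0)) => s; exact: vL. Qed.

Lemma curve_lipschitz t t' : 0 <= t -> 0 <= t' ->
  normL2 (g t - g t') <= L * `|t - t'|.
Proof.
move=> t0 t'0; apply: normL2_bounded.
- by apply: measurable_funB; exact: mg.
- by rewrite mulr_ge0.
- by move=> s; rewrite !fctE; exact: gL.
Qed.

Lemma curve_continuousL2 : continuousL2 g.
Proof.
split=> [t|t t0]; first exact: curve_L2.
apply/cvgrPdist_le => e e0; rewrite near_withinE.
have d0 : 0 < e / (L + 1) by rewrite divr_gt0// ltr_wpDl.
exists (e / (L + 1)) => //= r tr; rewrite in_itv/= andbT => r0.
rewrite sub0r normrN ger0_norm ?normL2_ge0//.
apply: le_trans (curve_lipschitz r0 t0) _.
have rt : `|r - t| <= e / (L + 1) by rewrite distrC ltW.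
apply: le_trans (ler_wpM2l L0 rt) _.
rewrite mulrCA ger_pMr// ler_pdivrMr ?mul1r; first by rewrite lerDl.
by rewrite ltr_wpDl.
Qed.

(** The difference quotients converge at almost every s and, as soon as |h| < t,
    are bounded by the Lipschitz constant. *)
Lemma curve_strong_derivative t : 0 < t -> strong_derivative g t (v t).
Proof.
move=> t0; split; first exact: velocity_L2.
apply/cvgr_dnbhsP => h [h0 hcvg].
have [N _ hN] : \forall n \near \oo, `|h n| < t.
  by move/cvgrPdist_lt : hcvg => /(_ _ t0); apply: filterS => n; rewrite sub0r normrN.
rewrite -(cvg_shiftn N).
have th n : 0 <= t + h (n + N)%N.
  have := hN (n + N)%N (leq_addl _ _); rewrite /= ltr_norml => /andP[+ _]; lra.
apply: (@normL2_cvg0 _ _ (cst (L + L))).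
- move=> n; apply: measurable_funB; last exact: mv.
  apply: (measurable_funM (measurable_cst _)).
  by apply: measurable_funB; apply: mg => //; exact: ltW.
- exact: L2_cst.
- move=> n s; rewrite !fctE [leRHS]ger0_norm ?addr_ge0//.
  rewrite (le_trans (ler_normB _ _))// lerD//; last exact: vL.
  rewrite normrZ normfV ler_pdivrMl ?normr_gt0// mulrC.
  by rewrite (le_trans (gL _ _ (ltW t0)))// addrAC subrr add0r.
- apply: (@filterS _ _ (ae_filter_ringOfSetsType leb01) _ _ _ (gv t0)) => s [dg gvs].
  have Q : h^-1 *: (g (t + h) s - g t s) @[h --> (0:R)^'] --> v t s.
    move: dg; rewrite -gvs /derive /derivable.
    under eq_fun => r do rewrite /= [r *: 1]mulr1 [r + t]addrC.
    exact.
  rewrite -(subrr (v t s)); apply: cvgB; last exact: cvg_cst.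
  move/cvgr_dnbhsP : Q; apply; split; first by move=> n; exact: h0.
  by rewrite (cvg_shiftn N).
Qed.

Section by_parts.
Variables (T B C : R) (phi dphi : R -> R).
Hypothesis T0 : 0 < T.
Hypothesis B0 : 0 <= B.
Hypothesis C0 : 0 <= C.
Hypothesis phiB : forall t : R, 0 <= t <= T -> `|phi t| <= B.
Hypothesis phiC : forall t t' : R, 0 <= t <= T -> 0 <= t' <= T ->
  `|phi t - phi t'| <= C * `|t - t'|.
Hypothesis dphiC : forall t : R, 0 < t < T -> `|dphi t| <= C.
Hypothesis phi_dphi : forall t : R, 0 < t < T -> is_derive t 1 phi (dphi t).

Let x k i := grid T k i.
Let dx k := mesh T k.

Let x0 k i : 0 <= x k i. Proof. exact: grid_ge0. Qed.
Let dx0 k : 0 < dx k. Proof. exact: mesh_gt0. Qed.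
Let dx_neq0 k : dx k != 0. Proof. by rewrite gt_eqF. Qed.
Let xS k i : x k i.+1 - x k i = dx k.
Proof. by rewrite /x gridS addrAC subrr add0r. Qed.
Let xT k i : (i <= 2 ^ k)%N -> 0 <= x k i <= T.
Proof. by move=> ik; rewrite x0 -[leRHS](grid_end T k) ler_grid. Qed.

(** Sums for the integral of g dphi.  They carry both terms of the integration by
    parts: the integral of phi' g directly, that of phi v by Abel summation. *)
Definition stieltjes_sum k : R -> R :=
  \sum_(i < 2 ^ k) (phi (x k i.+1) - phi (x k i)) *: g (x k i.+1).

Let K := C * L * T ^+ 2 / 4.

Let fct_sumE n (f : 'I_n -> R -> R) s : (\sum_(i < n) f i) s = \sum_(i < n) f i s.
Proof. by elim/big_ind2 : _ => // a b c d <- <-. Qed.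

(** Halving a cell moves the evaluation point of g on its left half by the new
    mesh.  The estimate is uniform in s, which is why the sums converge in
    L_2(0,1). *)
Lemma stieltjes_sum_refine k s :
  `|stieltjes_sum k.+1 s - stieltjes_sum k s| <= K / 2 ^+ k.
Proof.
rewrite /stieltjes_sum !fct_sumE expnS mul2n.
rewrite (sum_pairs
  (fun i => ((phi (x k.+1 i.+1) - phi (x k.+1 i)) *: g (x k.+1 i.+1)) s)).
rewrite -sumrB; apply: le_trans (ler_norm_sum _ _ _) _.
have -> : K / 2 ^+ k = \sum_(i < 2 ^ k) (C * dx k.+1 * (L * dx k.+1)).
  rewrite sumr_const card_ord -[RHS]mulr_natr natrX /dx /mesh /K [2 ^+ k.+1]exprS.
  have : (2 : R) ^+ k != 0 by rewrite expf_neq0.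
  by move=> h; field.
apply: ler_sum => i _; rewrite -doubleS /x !grid_refine -/(x k i) -/(x k i.+1).
rewrite !fctE -[grid T k.+1 i.*2.+1]/(x k.+1 i.*2.+1).
set a := x k.+1 i.*2.+1; set p := x k i; set q := x k i.+1.
have pE : p = x k.+1 i.*2 by rewrite /p /x grid_refine.
have qE : q = x k.+1 i.*2.+2 by rewrite /q /x -doubleS grid_refine.
rewrite (_ : _ - _ = (phi a - phi p) * (g a s - g q s)); last first.
  by rewrite /GRing.scale/=; ring.
have i2 : (i.*2.+2 <= 2 ^ k.+1)%N by rewrite expnS mul2n -doubleS leq_double.
rewrite normrM; apply: ler_pM => //.
- have -> : dx k.+1 = `|a - p| by rewrite pE xS gtr0_norm.
  by apply: phiC; rewrite ?pE; apply: xT; rewrite (leq_trans _ i2)// ltnW.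
- have -> : dx k.+1 = `|a - q| by rewrite distrC qE xS gtr0_norm.
  by apply: gL; rewrite ?qE; exact: x0.
Qed.

Lemma stieltjes_sum_L2 k : L2 (stieltjes_sum k).
Proof. by apply: L2_sum => i; apply: L2Z; exact: curve_L2. Qed.

Lemma stieltjes_cvg : exists J, L2 J /\
  normL2 (J - stieltjes_sum k) @[k --> \oo] --> (0 : R).
Proof.
have /choice[J HJ] : forall s, exists l,
    stieltjes_sum k s @[k --> \oo] --> l /\
    forall k, `|stieltjes_sum k s - l| <= 2 * K / 2 ^+ k.
  by move=> s; apply: geometric_cvg => k; exact: stieltjes_sum_refine.
have mJ : measurable_fun [set: R] J.
  apply: (@measurable_fun_cvg _ _ _ _ stieltjes_sum).
  - by move=> k; exact: L2_measurable (stieltjes_sum_L2 k).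
  - by move=> s _; case: (HJ s).
have K0 : 0 <= K by rewrite /K divr_ge0// (mulr_ge0 _ (sqr_ge0 T))// mulr_ge0.
have mJS k : measurable_fun [set: R] (J - stieltjes_sum k).
  by apply: measurable_funB => //; exact: L2_measurable (stieltjes_sum_L2 k).
have JS k s : `|(J - stieltjes_sum k) s| <= mesh (2 * K) k.
  by rewrite !fctE distrC; case: (HJ s) => _; apply.
have e0 k : 0 <= mesh (2 * K) k by apply: divr_ge0; [exact: mulr_ge0|exact: exprn_ge0].
exists J; split.
  rewrite -(subrK (stieltjes_sum 0) J); apply: L2D; last exact: stieltjes_sum_L2.
  exact: L2_bounded (JS 0%N).
apply/cvgrPdist_le => e ep; move/cvgrPdist_le : (mesh_cvg0 (2 * K)) => /(_ _ ep).
apply: filterS => k; rewrite !sub0r !normrN ger0_norm// ger0_norm ?normL2_ge0//.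
by apply: le_trans; exact: normL2_bounded (JS k).
Qed.

Lemma abel_summation k :
  \sum_(i < 2 ^ k) phi (x k i) *: (g (x k i.+1) - g (x k i)) =
  phi T *: g T - phi 0 *: g 0 - stieltjes_sum k.
Proof.
apply/eqP; rewrite -subr_eq0 opprB addrA subr_eq0 /stieltjes_sum -big_split/=.
rewrite (eq_bigr (fun i : 'I_(2 ^ k) => (fun j => phi (x k j) *: g (x k j)) i.+1 -
   (fun j => phi (x k j) *: g (x k j)) i)); last first.
  by move=> i _ /=; apply/funext => s; rewrite !fctE /GRing.scale/=; ring.
rewrite -(big_mkord xpredT (fun i => (fun j => phi (x k j) *: g (x k j)) i.+1 -
   (fun j => phi (x k j) *: g (x k j)) i)) telescope_sumr//.
by rewrite /x grid_end grid0.
Qed.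

Let cell_bounds t k i : 0 < t < T -> cell T k i t ->
  [/\ x k i < t, t <= x k i.+1 & (i.+1 <= 2 ^ k)%N].
Proof.
move=> /andP[t0 tT]; rewrite /cell /= in_itv/= => /andP[it ti]; split => //.
by rewrite ltnNge -(ler_grid k _ _ T0) grid_end -ltNge (lt_trans it).
Qed.

Let q k i : R := (dx k)^-1 * (phi (x k i.+1) - phi (x k i)).

Let qC k i : (i.+1 <= 2 ^ k)%N -> `|q k i| <= C.
Proof.
move=> ik; rewrite normrM normfV (gtr0_norm (dx0 k)) ler_pdivrMl// mulrC.
rewrite -[dx k in leRHS](gtr0_norm (dx0 k)) -(xS k i); apply: phiC; apply: xT => //.
exact: ltnW.
Qed.

Let cvg_grid t (i : nat -> nat) : (forall k, cell T k (i k) t) ->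
  x k (i k) @[k --> \oo] --> t /\ x k (i k).+1 @[k --> \oo] --> t.
Proof.
move=> ti; split; apply/cvgrPdist_le => e e0;
  move/cvgrPdist_le : (mesh_cvg0 T) => /(_ _ e0); apply: filterS => k;
  rewrite sub0r normrN (gtr0_norm (dx0 k)); apply: le_trans;
  rewrite -(xS k (i k)); move: (ti k); rewrite /cell /= in_itv/= => /andP[a b];
  rewrite ler_norml; apply/andP; split; rewrite /x; lra.
Qed.

(** On each cell phi' is replaced by the slope of phi, so that the integral of
    the step function is exactly the Stieltjes sum. *)
Lemma phi'_curve_bochner J :
  L2 J -> normL2 (J - stieltjes_sum k) @[k --> \oo] --> (0 : R) ->
  is_bochner_integral `]0, T[ (fun t => dphi t *: g t) J.
Proof.
move=> LJ cJ; pose c k i := q k i *: g (x k i.+1).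
have dom t k i s : 0 < t < T -> cell T k i t ->
    `|(dphi t *: g t - c k i) s| <= `|((C + C) *: G) s|.
  move=> tT ti; have [it _ ik] := cell_bounds tT ti.
  have t0 : 0 <= t by case/andP: tT => /ltW.
  rewrite /c !fctE [leRHS]ger0_norm ?mulr_ge0 ?addr_ge0//.
  rewrite (le_trans (ler_normB _ _))// !normrZ [leRHS]mulrDl.
  rewrite -[`|_^-1| * _]normrM.
  by apply: lerD; apply: ler_pM => //; [exact: dphiC|exact: gG|exact: qC|exact: gG].
have m t k i : 0 < t < T -> measurable_fun [set: R] (dphi t *: g t - c k i).
  move=> /andP[/ltW t0 _].
  by apply: measurable_funB; apply: measurable_scale; exact: mg.
apply: (@step_is_bochner_integral _ _ _ _ c (normL2 ((C + C) *: G))) => //.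
- by move=> t /andP[t0 _]; apply: L2Z; exact: curve_L2 (ltW t0).
- by move=> k i; apply: L2Z; exact: curve_L2.
- move=> t k i tT ti; apply: normL2_dom; [exact: m|exact: L2Z|].
  by move=> s; exact: dom.
- move=> t i tT ti; apply: (normL2_cvg0 _ (L2Z (C + C) LG)).
  + by move=> k; exact: m.
  + by move=> k s; exact: dom.
  + apply: aeW => s; rewrite -(subrr (dphi t * g t s)).
    apply: cvgB; first exact: cvg_cst.
    have t0 : 0 <= t by case/andP: tT => /ltW.
    apply: cvgM.
      rewrite (_ : (fun k => _) = (fun k => (x k (i k).+1 - x k (i k))^-1 *
          (phi (x k (i k).+1) - phi (x k (i k))))); last first.
        by apply/funext => k; rewrite xS.
      apply: (is_derive_straddle (phi_dphi tT)).
        by move=> k; have [-> ->] := cell_bounds tT (ti k).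
      by under eq_cvg do rewrite xS; exact: mesh_cvg0.
    have [_ xt] := cvg_grid ti; apply/cvgrPdist_le => e e0.
    have e1 : 0 < e / (L + 1) by rewrite divr_gt0// ltr_wpDl.
    move/cvgrPdist_le : xt => /(_ _ e1); apply: filterS => k tx.
    rewrite (le_trans (gL s t0 (x0 _ _)))// (le_trans (ler_wpM2l L0 tx))//.
    by rewrite mulrCA ger_pMr// ler_pdivrMr ?mul1r ?lerDl// ltr_wpDl.
- rewrite (_ : (fun k => _) = (fun k => normL2 (J - stieltjes_sum k)))//.
  apply/funext => k; congr (normL2 (_ - _)); apply: eq_bigr => i _.
  by rewrite /c scalerA mulrA mulfV// mul1r.
Qed.

(** On each cell the velocity is replaced by the slope of the curve.  Abel
    summation turns the integral of the step function into the same Stieltjes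
    sum, and dominated convergence gives the convergence of the slopes in
    L_2(0,1) from that at almost every s. *)
Lemma phi_velocity_bochner J :
  L2 J -> normL2 (J - stieltjes_sum k) @[k --> \oo] --> (0 : R) ->
  is_bochner_integral `]0, T[ (fun t => phi t *: v t)
    (phi T *: g T - phi 0 *: g 0 - J).
Proof.
move=> LJ cJ.
pose c k i := ((dx k)^-1 * phi (x k i)) *: (g (x k i.+1) - g (x k i)).
have lt01 t : 0 < t < T -> 0 < t by case/andP.
have dom t k i s : 0 < t < T -> cell T k i t ->
    `|(phi t *: v t - c k i) s| <= B * L + B * L.
  move=> tT ti; have [it _ ik] := cell_bounds tT ti.
  have [t0 t0T] : 0 < t /\ 0 <= t <= T by case/andP: tT => /[dup] ? /ltW -> /ltW ->.
  rewrite /c !fctE (le_trans (ler_normB _ _))// !normrZ; apply: lerD.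
    by apply: ler_pM; rewrite ?phiB ?vL.
  rewrite mulrAC mulrC; apply: ler_pM => //.
  - by apply: phiB; apply: xT; exact: ltnW.
  - rewrite normfV (gtr0_norm (dx0 k)) ler_pdivrMl// mulrC.
    by rewrite -[dx k in leRHS](gtr0_norm (dx0 k)) -(xS k i); exact: gL.
have m t k i : 0 < t < T -> measurable_fun [set: R] (phi t *: v t - c k i).
  move=> /lt01 t0; apply: measurable_funB;
    apply: measurable_scale; first exact: mv.
  by apply: measurable_funB; exact: mg.
have M0 : 0 <= B * L + B * L by rewrite addr_ge0 ?mulr_ge0.
apply: (@step_is_bochner_integral _ _ _ _ c (B * L + B * L)) => //.
- by move=> t /lt01 t0; apply: L2Z; exact: velocity_L2.
- by apply: L2B => //; apply: L2B; apply: L2Z; apply: curve_L2 => //; exact: ltW.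
- by move=> k i; apply: L2Z; apply: L2B; exact: curve_L2.
- move=> t k i tT ti; apply: normL2_bounded => //; first exact: m.
  by move=> s; exact: dom.
- move=> t i tT ti; apply: (normL2_cvg0 _ (L2_cst (B * L + B * L))).
  + by move=> k; exact: m.
  + by move=> k s /=; rewrite [leRHS]ger0_norm//; exact: dom.
  + apply: (@filterS _ _ (ae_filter_ringOfSetsType leb01) _ _ _ (gv (lt01 _ tT))).
    move=> s gvs; rewrite -(subrr (phi t * v t s)).
    apply: cvgB; first exact: cvg_cst.
    rewrite (_ : (fun k => _) = (fun k => phi (x k (i k)) *
        ((x k (i k).+1 - x k (i k))^-1 *
          (g (x k (i k).+1) s - g (x k (i k)) s)))); last first.
      by apply/funext => k; rewrite xS /c !fctE /GRing.scale/=; ring.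
    apply: cvgM; last first.
      apply: (is_derive_straddle gvs).
        by move=> k; have [-> ->] := cell_bounds tT (ti k).
      by under eq_cvg do rewrite xS; exact: mesh_cvg0.
    have [xt _] := cvg_grid ti; have [dphit _] := phi_dphi tT.
    have phic : {for t, continuous phi}.
      exact/differentiable_continuous/derivable1_diffP.
    exact: continuous_cvg _ phic xt.
- rewrite (_ : (fun k => _) = (fun k => normL2 (J - stieltjes_sum k)))//.
  apply/funext => k; rewrite [RHS]normL2C; congr (normL2 _).
  rewrite (eq_bigr (fun i : 'I_(2 ^ k) =>
    phi (x k i) *: (g (x k i.+1) - g (x k i)))); last first.
    by move=> i _; rewrite /c scalerA mulrA mulfV// mul1r.
  by rewrite abel_summation opprB addrC addrA addrNK.
Qed.

End by_parts.

(** The two integrals above for phi = id, for phi = 1 and for a test function: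
    in the last case the boundary terms vanish and the integrals are opposite. *)
Lemma curve_W11 T : 0 < T -> W11 T g.
Proof.
move=> T0; split; last exists v.
- have id01 (t : R) : 0 <= t <= T -> `|t| <= T by move=> /andP[t0 tT]; rewrite ger0_norm.
  have idC (t t' : R) : 0 <= t <= T -> 0 <= t' <= T -> `|t - t'| <= 1 * `|t - t'|.
    by rewrite mul1r.
  have did (t : R) : 0 < t < T -> is_derive t 1 (@idfun R) 1.
    by move=> _; exact: is_derive_id.
  have d1 (t : R) : 0 < t < T -> `|cst 1 t : R| <= 1 by rewrite normr1.
  have [J [LJ cJ]] := stieltjes_cvg T0 ler01 idC.
  have := phi'_curve_bochner T0 ler01 idC d1 did LJ cJ.
  rewrite (_ : (fun t => _ *: g t) = g); first by exists J.
  by apply/funext => t; rewrite scale1r.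
- have b1 (t : R) : 0 <= t <= T -> `|cst 1 t : R| <= 1 by rewrite normr1.
  have c1 (t t' : R) : 0 <= t <= T -> 0 <= t' <= T ->
      `|cst 1 t - cst 1 t' : R| <= 0 * `|t - t'| by rewrite subrr normr0 mul0r.
  have d1 (t : R) : 0 < t < T -> is_derive t 1 (cst 1 : R -> R) 0.
    by move=> _; exact: is_derive_cst.
  have [J [LJ cJ]] := stieltjes_cvg T0 (lexx 0) c1.
  have := phi_velocity_bochner T0 ler01 b1 d1 LJ cJ.
  rewrite (_ : (fun t => _ *: v t) = v); first by move=> H; eexists; exact: H.
  by apply/funext => t; rewrite scale1r.
- move=> phi [dphi [a [b [a0 bT ab]]]].
  have d0 (t : R) : is_derive t 1 phi (derive1 phi t).
    by rewrite derive1E; apply: derivableP; exact: (dphi 0%N).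
  have dphic : continuous (derive1 phi).
    by move=> t; apply/differentiable_continuous/derivable1_diffP; exact: (dphi 1%N).
  have phic : continuous phi.
    by move=> t; apply/differentiable_continuous/derivable1_diffP; exact: (dphi 0%N).
  have bound (f : R -> R) : continuous f ->
      exists2 c, 0 <= c & forall t, 0 <= t <= T -> `|f t| <= c.
    move=> fc; have cf : {within `[0, T], continuous (fun t => `|f t|)}.
      apply: continuous_subspaceT => t.
      exact: (continuous_comp (fc t) (@norm_continuous _ _ _)).
    have [c _ H] := EVT_max (ltW T0) cf.
    by exists `|f c| => // t tT; apply: H; rewrite in_itv.
  have [B B0 phiB] := bound _ phic.
  have [C C0 dphiC] := bound _ dphic.
  have phiC t t' : 0 <= t <= T -> 0 <= t' <= T ->
      `|phi t - phi t'| <= C * `|t - t'|.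
    wlog : t t' / t <= t' => [H|tt'].
      move=> tT t'T; case/orP: (le_total t t') => tt'; first exact: H.
      by rewrite distrC [`|t - _|]distrC; exact: H.
    move=> /andP[t0 tT] /andP[t'0 t'T].
    have [c ctt' E] := MVT_segment tt' (fun x _ => d0 x)
      (continuous_subspaceT phic).
    rewrite distrC E normrM [`|t' - _|]distrC ler_wpM2r// dphiC//.
    by move: ctt'; rewrite in_itv/= => /andP[tc ct]; apply/andP; split; lra.
  have dphiC' (t : R) : 0 < t < T -> `|derive1 phi t| <= C.
    by move=> /andP[t0 tT]; apply: dphiC; rewrite !ltW.
  have [J [LJ cJ]] := stieltjes_cvg T0 C0 phiC.
  exists J; first exact: (phi'_curve_bochner T0 C0 phiC dphiC' (fun t _ => d0 t) LJ cJ).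
  have phi0 (t : R) : ~~ (a <= t <= b) -> phi t = 0.
    by move=> tab; apply/eqP; apply: contraNT tab; exact: ab.
  have := phi_velocity_bochner T0 B0 phiB (fun t _ => d0 t) LJ cJ.
  rewrite !phi0 ?scale0r ?subrr ?sub0r//.
  + by rewrite negb_and -!ltNge a0.
  + by rewrite negb_and -!ltNge bT orbT.
Qed.

End lipschitz_curve.

(** * Distribution functions and quantile functions *)

Section countability.
Context {R : realType}.

(** The intervals ]l x, r x[ are disjoint, and each contains a rational. *)
Lemma countable_jumps (S : set R) (l r : R -> R) :
  (forall x, S x -> l x < r x) ->
  (forall x y, S x -> S y -> x < y -> r x <= l y) -> countable S.
Proof.
move=> lr rl.
have /choice[q qP] : forall x, exists q : rat, S x -> l x < ratr q < r x.
  move=> x; have [Sx|nSx] := pselect (S x); last by exists 0.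
  have [q] := rat_in_itvoo (lr _ Sx); rewrite in_itv/= => ?; by exists q.
apply/countable_injP; exists (fun x => pickle (q x)) => x y /set_mem Sx /set_mem Sy.
move=> /(pcan_inj pickleK) qxy.
have {}rl a b : S a -> S b -> q a = q b -> ~~ (a < b).
  move=> Sa Sb qab; apply/negP => ab.
  have /andP[_ qa] := qP _ Sa; have /andP[qb _] := qP _ Sb.
  by have := lt_trans (lt_le_trans qa (rl _ _ Sa Sb ab)) qb; rewrite qab ltxx.
have := rl _ _ Sx Sy qxy; have := rl _ _ Sy Sx (esym qxy).
by rewrite -!leNgt => h1 h2; apply/le_anti; rewrite h1 h2.
Qed.

Lemma countableU (A B : set R) : countable A -> countable B ->
  countable (A `|` B).
Proof.
move=> cA cB; rewrite -bigcup2E; apply: bigcup_countable => //.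
by move=> [|[|i]] _.
Qed.

(** Monotonicity is required on D only: the preimage of a half-line is then the
    trace on D of an interval, its upward closure. *)
Lemma monotone_measurable (D : set R) (f : R -> R) :
  measurable (D : set (measurableTypeR R)) ->
  (forall x y, D x -> D y -> x <= y -> f x <= f y) ->
  measurable_fun (D : set (measurableTypeR R)) f.
Proof.
move=> mD ndf.
apply: (measurability (@RGenCInfty.G R)); first exact: RGenCInfty.measurableE.
move=> _ [_] [r] -> <-.
pose U := [set x | exists y, [/\ D y, y <= x & r <= f y]].
rewrite (_ : _ `&` _ = D `&` U); last first.
  apply/seteqP; split=> [x [Dx]|x [Dx] [y [Dy yx ry]]].
    by rewrite /= in_itv/= andbT => rx; split => //; exists x.
  by split => //=; rewrite in_itv/= andbT (le_trans ry)// ndf.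
apply: measurableI => //; apply: is_interval_measurable => s t.
move=> [y [Dy ys ry]] _ u /andP[su _].
by exists y; split => //; rewrite (le_trans ys).
Qed.

End countability.

Section distribution_functions.
Context {R : realType}.
Variable mu : probability (measurableTypeR R) R.
Implicit Types x y s : R.

Let mu_itv (i : interval R) : mu [set` i] = (fine (mu [set` i]))%:E.
Proof. by rewrite fineK// fin_num_measure//; exact: measurable_itv. Qed.

Lemma RplusE x : mu `]-oo, x]%classic = (Rplus mu x)%:E.
Proof. exact: mu_itv. Qed.

Lemma RminusE x : mu `]-oo, x[%classic = (Rminus mu x)%:E.
Proof. exact: mu_itv. Qed.

Let mu_sub (i j : interval R) : [set` i] `<=` [set` j] ->
  fine (mu [set` i]) <= fine (mu [set` j]).
Proof.
move=> ij; rewrite -lee_fin -!mu_itv.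
by apply: le_measure => //; rewrite inE; exact: measurable_itv.
Qed.

Lemma Rplus_nd x y : x <= y -> Rplus mu x <= Rplus mu y.
Proof.
move=> xy; apply: mu_sub => z /=; rewrite !in_itv/= => /le_trans; exact.
Qed.

Lemma Rminus_nd x y : x <= y -> Rminus mu x <= Rminus mu y.
Proof.
move=> xy; apply: mu_sub => z /=; rewrite !in_itv/= => /lt_le_trans; exact.
Qed.

Lemma Rminus_le_Rplus x : Rminus mu x <= Rplus mu x.
Proof. by apply: mu_sub => z /=; rewrite !in_itv/= => /ltW. Qed.

Lemma Rplus_le_Rminus x y : x < y -> Rplus mu x <= Rminus mu y.
Proof.
move=> xy; apply: mu_sub => z /=; rewrite !in_itv/= => /le_lt_trans; exact.
Qed.

Lemma Rminus_ge0 x : 0 <= Rminus mu x.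
Proof. exact/fine_ge0. Qed.

Lemma Rplus_le1 x : Rplus mu x <= 1.
Proof. by rewrite -lee_fin -RplusE; apply: probability_le1; exact: measurable_itv. Qed.

Let idTR : measurableTypeR R -> R := idfun.

#[local] HB.instance Definition _ :=
  @isMeasurableFun.Build _ _ _ _ idTR (@measurable_id _ _ setT).

Lemma Rplus_large s : s < 1 -> exists x, s <= Rplus mu x.
Proof.
move=> s1; have h : Rplus mu x @[x --> +oo] --> (1 : R).
  exact: (fine_cvg (cvg_cdfy1 (idTR : {RV mu >-> R}))).
have : \forall x \near +oo, s <= Rplus mu x.
  by move/cvgr_ge : h; apply.
by move=> [M [_ H]]; exists (M + 1); apply: H; rewrite ltrDl.
Qed.

Lemma Rplus_small s : 0 < s -> exists x, Rplus mu x < s.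
Proof.
move=> s0; have h : Rplus mu x @[x --> -oo] --> (0 : R).
  exact: (fine_cvg (cvg_cdfNy0 (idTR : {RV mu >-> R}))).
have : \forall x \near -oo, Rplus mu x < s.
  by move/cvgr_lt : h; apply.
by move=> [M [_ H]]; exists (M - 1); apply: H; rewrite ltrBlDr ltrDl.
Qed.

Lemma Rplus_right_lt x s : Rplus mu x < s -> exists2 y, x < y & Rplus mu y < s.
Proof.
move=> xs; have h : Rplus mu y @[y --> x^'+] --> Rplus mu x.
  apply: fine_cvg; rewrite -RplusE.
  exact: (cdf_right_continuous (X := (idTR : {RV mu >-> R}))).
have : \forall y \near x^'+, Rplus mu y < s by move/cvgr_lt : h; apply.
move=> H; near x^'+ => y; exists y; near: y => //.
exact: nbhs_right_gt.
Unshelve. all: by end_near. Qed.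

Lemma Rminus_left_gt x s : s < Rminus mu x -> exists2 y, y < x & s < Rplus mu y.
Proof.
move=> sx; pose F n := `]-oo, (x - n.+1%:R^-1)]%classic : set (measurableTypeR R).
have FE : `]-oo, x[%classic = \bigcup_n F n.
  apply/seteqP; split=> z; last first.
    move=> [n _]; rewrite /F /= !in_itv/= => /le_lt_trans; apply.
    by rewrite ltrBlDr ltrDl invr_gt0.
  rewrite /= in_itv/= => zx; exists (Num.truncn (x - z)^-1) => //.
  rewrite /F/= in_itv/= lerBrDl addrC -lerBrDl ltW//.
  by rewrite invf_plt ?posrE ?subr_gt0 ?ltr0n// truncnS_gt.
have : mu (F n) @[n --> \oo] --> mu (\bigcup_n F n).
  apply: nondecreasing_cvg_mu.
  - by move=> n; exact: measurable_itv.
  - by rewrite -FE; exact: measurable_itv.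
  - move=> n m nm; apply/subsetPset => z; rewrite /F/= !in_itv/= => /le_trans; apply.
    by rewrite lerB// lef_pV2 ?posrE// ler_nat.
rewrite -FE RminusE -lte_fin in sx *.
move/(_ _ (open_nbhs_nbhs (conj (@open_ereal_gt_ereal _ _) sx))).
move=> [N _ /(_ _ (leqnn N)) H]; exists (x - N.+1%:R^-1).
  by rewrite ltrBlDr ltrDl invr_gt0.
have {}H : (s%:E < mu (F N))%E := H.
by rewrite -lte_fin -RplusE.
Qed.

(** The Galois connection between quantiles and distribution functions; the
    minimum that defines the quantile is attained by right continuity. *)
Lemma quantile_le s x : 0 < s < 1 -> (quantile mu s <= x) = (s <= Rplus mu x).
Proof.
move=> /andP[s0 s1]; pose A := [set x | s <= Rplus mu x].
have [x1 sx1] := Rplus_large s1; have [x0 x0s] := Rplus_small s0.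
have lbA : lbound A x0.
  move=> y; rewrite /A/= => sy; rewrite leNgt; apply/negP => /ltW/Rplus_nd yx0.
  by have := le_lt_trans (le_trans sy yx0) x0s; rewrite ltxx.
have iA : has_inf A by split; [exists x1|exists x0].
have Am : A (inf A).
  rewrite /A/= leNgt; apply/negP => /Rplus_right_lt[y my ys].
  have ym : 0 < y - inf A by rewrite subr_gt0.
  have [z Az] := inf_adherent ym iA; rewrite addrC subrK => zy.
  have := le_lt_trans Az (le_lt_trans (Rplus_nd (ltW zy)) ys).
  by rewrite ltxx.
have lbm : lbound A (inf A) by move=> y Ay; apply: ge_inf => //; exact: (proj2 iA).
have [mQ lQ] : (A `&` lbound A) (quantile mu s).
  by rewrite /quantile /minimum; apply: xgetPex; exists (inf A).
apply/idP/idP => [Qx|sx]; last exact: lQ.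
exact: le_trans mQ (Rplus_nd Qx).
Qed.

Lemma quantile_nd s t : 0 < s < 1 -> 0 < t < 1 -> s <= t ->
  quantile mu s <= quantile mu t.
Proof.
move=> s01 t01 st; rewrite quantile_le// (le_trans st)//.
by rewrite -quantile_le.
Qed.

Lemma Rplus_quantile s : 0 < s < 1 -> s <= Rplus mu (quantile mu s).
Proof. by move=> s01; rewrite -quantile_le. Qed.

Lemma Rplus_lt_quantile s x : 0 < s < 1 -> x < quantile mu s -> Rplus mu x < s.
Proof. by move=> s01; rewrite !ltNge quantile_le. Qed.

Lemma quantile_out s : ~~ (0 < s <= 1) -> quantile mu s = 0.
Proof.
move=> s01; rewrite /quantile /minimum xgetPN// => x [/= sx lx].
have : x <= x - 1.
  apply: lx => /=; have [s0|s0] := leP s 0.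
    exact: le_trans s0 (le_trans (Rminus_ge0 _) (Rminus_le_Rplus _)).
  by move: s01; rewrite s0 -ltNge => /(le_lt_trans (Rplus_le1 x)); rewrite ltNge sx.
by rewrite lerBrDr gerDl ler10.
Qed.

(** The quantile function is monotone on ]0, 1[ and 0 outside of ]0, 1]; its
    value at 1 may be anything. *)
Lemma measurable_quantile : measurable_fun [set: R] (quantile mu).
Proof.
have mI : measurable (`]0, 1[%classic : set (measurableTypeR R)).
  exact: measurable_itv.
have -> : quantile mu = (quantile mu) \_ `]0, 1[ \+
    (fun s => quantile mu 1 * \1_[set (1 : R)] s).
  apply/funext => s /=; rewrite /patch indicE.
  case: ifPn; rewrite ?inE ?notin_setE/= in_itv/=.
    move=> /andP[_ s1]; rewrite memNset ?mulr0 ?addr0//= => s1'.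
    by rewrite s1' ltxx in s1.
  move=> s01; have [->|s1] := eqVneq s 1; first by rewrite mem_set// mulr1 add0r.
  rewrite memNset ?mulr0 ?addr0; last by move=> /= E; rewrite E eqxx in s1.
  apply: quantile_out; apply/negP => /andP[s0 s1']; apply: s01.
  by rewrite s0 lt_neqAle s1.
apply: measurable_funD; last first.
  apply: (measurable_funM (measurable_cst _)).
  by apply: measurable_indic; exact: measurable_set1.
apply/(measurable_restrictT _ mI).
apply: monotone_measurable => // s t; rewrite /= !in_itv/=; exact: quantile_nd.
Qed.

(** The quantile function transports Lebesgue measure on the unit interval to
    the given measure: by the Galois connection above, both measures give
    mass [Rplus b - Rplus a] to the interval ]a, b]. *)
Lemma leb01_quantile (A : set (measurableTypeR R)) : measurable A ->
  leb01 (quantile mu @^-1` A) = mu A.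
Proof.
move=> mA; have mQ := measurable_quantile.
have mI (i : interval R) : measurable ([set` i] : set (measurableTypeR R)).
  exact: measurable_itv.
have E (a b : R) : leb01 (quantile mu @^-1` `]a, b]%classic) = mu `]a, b]%classic.
  have [ab|ba] := ltP a b; last first.
    by rewrite set_itv_ge ?preimage_set0 ?measure0// bnd_simp -leNgt.
  have -> : mu `]a, b]%classic = (Rplus mu b - Rplus mu a)%:E.
    have -> : `]a, b]%classic = `]-oo, b] `\` `]-oo, a] :> set R.
      by rewrite -[RHS]setCK setCD setCitvl setUC -[LHS]setCK setCitv.
    have sub : `]-oo, a]%classic `<=` `]-oo, b]%classic.
      by apply: subset_itvl; rewrite bnd_simp ltW.
    have fin : (mu `]-oo, b]%classic < +oo)%E.
      by rewrite -ge0_fin_numE// fin_num_measure.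
    by rewrite measureD// (setIidr sub) EFinB -!RplusE.
  have QE s : (quantile mu @^-1` `]a, b] `&` `]0, 1[)%classic s <->
      0 < s < 1 /\ Rplus mu a < s <= Rplus mu b.
    rewrite /= !in_itv/=; split=> [[/andP[aQ Qb] s01]|[s01 /andP[as_ sb]]]; split => //.
      by rewrite -quantile_le// Qb andbT Rplus_lt_quantile.
    by rewrite quantile_le// sb andbT ltNge quantile_le// -ltNge.
  have L (t : bool) : @lebesgue_measure R [set` Interval (BRight (Rplus mu a))
      (BSide t (Rplus mu b))] = (Rplus mu b - Rplus mu a)%:E.
    rewrite lebesgue_measure_itv/= lte_fin; case: ltP => [_|h]; first by rewrite EFinB.
    rewrite (_ : Rplus mu a = Rplus mu b) ?subrr//.
    by apply/le_anti; rewrite h Rplus_nd// ltW.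
  rewrite /leb01 /= /mrestr.
  have mS : measurable (quantile mu @^-1` `]a, b] `&` `]0, 1[ : set (measurableTypeR R)).
    by apply: measurableI => //; rewrite -[X in measurable X]setTI; exact: mQ.
  apply/eqP; rewrite eq_le; apply/andP; split.
  - rewrite -(L false); apply: le_measure; rewrite ?inE//.
    by move=> s /QE[_ sab]; rewrite /= in_itv.
  - rewrite -(L true); apply: le_measure; rewrite ?inE//.
    move=> s; rewrite /= in_itv/= => /andP[as_ sb]; apply/QE.
    rewrite as_ ltW//; split => //; apply/andP; split.
      by apply: le_lt_trans as_; rewrite (le_trans (Rminus_ge0 a))// Rminus_le_Rplus.
    by apply: lt_le_trans sb _; exact: Rplus_le1.
pose Qm : {measure set (measurableTypeR R) -> \bar R} :=
  @pushforward _ _ (measurableTypeR R) (measurableTypeR R) R leb01 (quantile mu).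
change (Qm mQ A = mu A); apply: (@measure_unique _ R (measurableTypeR R) (@ocitv R)
  (fun n => `]- n%:R, n%:R]%classic) erefl _ _ _ (Qm mQ) mu) => //.
- exact: ocitvI.
- by move=> n; exact: is_ocitv.
- apply/seteqP; split => // x _; exists (Num.truncn `|x|).+1 => //=.
  have := truncnS_gt `|x|; rewrite ltr_norml in_itv/= => /andP[-> ?]; exact: ltW.
- by move=> _ [[a b] _ <-] /=; exact: E.
- move=> n; rewrite /Qm/= /pushforward E -ge0_fin_numE// fin_num_measure//.
Qed.

Lemma quantile_L2 : finite_second_moment mu -> L2 (quantile mu).
Proof.
move=> mu2; apply/L2P; split; first exact: measurable_quantile.
apply: le_lt_trans mu2; have mQ := measurable_quantile.
pose f (x : measurableTypeR R) : \bar R := (x ^+ 2)%:E.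
have mf : measurable_fun [set: measurableTypeR R] f.
  by apply/measurable_EFinP; exact: measurable_funX.
have := @ge0_integral_pushforward _ _ (measurableTypeR R) (measurableTypeR R) R
  (quantile mu) mQ leb01 setT f measurableT mf.
rewrite preimage_setT => <-; last by move=> x _; rewrite /f lee_fin sqr_ge0.
rewrite le_eqVlt; apply/orP; left; apply/eqP.
apply: eq_measure_integral => A mA _; exact: leb01_quantile.
Qed.

(** The levels whose quantile is below [quantile mu s] lie in ]0, s[, and they
    form a set of measure [Rminus mu (quantile mu s)]. *)
Lemma Rminus_quantile s : 0 < s < 1 -> Rminus mu (quantile mu s) <= s.
Proof.
move=> s01; rewrite -lee_fin -RminusE -leb01_quantile; last exact: measurable_itv.
have -> : s%:E = @lebesgue_measure R `]0, s[%classic.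
  by rewrite lebesgue_measure_itv/= lte_fin (andP s01).1 sube0.
rewrite /leb01/= /mrestr; apply: le_measure; rewrite ?inE.
- apply: measurableI; last exact: measurable_itv.
  rewrite -[X in measurable X]setTI; apply: measurable_quantile => //.
  exact: measurable_itv.
- move=> t; rewrite /= !in_itv/= => -[Qts t01].
  rewrite (andP t01).1/= ltNge; apply: contraL Qts => st.
  by rewrite -leNgt; exact: quantile_nd.
Qed.

Lemma continuity_point01 s : quantile_continuity_points mu s -> 0 < s < 1.
Proof. by case. Qed.

(** By continuity some level t > s still has its quantile below x.  Without
    continuity the distribution function may be equal to s on an interval above
    [quantile mu s], where the flow would not move. *)
Lemma lt_Rminus_of_continuity s x : quantile_continuity_points mu s ->
  quantile mu s < x -> s < Rminus mu x.
Proof.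
move=> [s01 cs] Qx; have s1 : s < 1 by case/andP: s01.
have : \forall t \near s, quantile mu t < x by move/cvgr_lt : cs; apply.
move=> [e /= e0 H].
pose t := s + Num.min (e / 2) ((1 - s) / 2).
have m0 : 0 < Num.min (e / 2) ((1 - s) / 2).
  by rewrite lt_min !divr_gt0// subr_gt0.
have st : s < t by rewrite ltrDl.
have m1 : Num.min (e / 2) ((1 - s) / 2) <= e / 2 by rewrite ge_min lexx.
have m2 : Num.min (e / 2) ((1 - s) / 2) <= (1 - s) / 2 by rewrite ge_min lexx orbT.
have t01 : 0 < t < 1.
  by case/andP: s01 => s0 _; apply/andP; split; rewrite /t; lra.
have Qt : quantile mu t < x.
  apply: H; rewrite /= /t opprD addrA subrr sub0r normrN gtr0_norm//; lra.
apply: lt_le_trans st _; apply: le_trans (Rplus_quantile t01) _.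
exact: Rplus_le_Rminus.
Qed.

(** A discontinuity of a monotone function is a jump from the left (in [JL]) or
    to the right (in [JR]). *)
Lemma countable_discontinuity :
  countable (`]0, 1[%classic `\` quantile_continuity_points mu).
Proof.
pose jl s (e : R) := 0 < e /\
  forall t, 0 < t < s -> quantile mu t <= quantile mu s - e.
pose jr s (e : R) := 0 < e /\
  forall t, s < t < 1 -> quantile mu s + e <= quantile mu t.
pose JL := [set s | 0 < s < 1 /\ exists e, jl s e].
pose JR := [set s | 0 < s < 1 /\ exists e, jr s e].
have cL : countable JL.
  have /choice[e eP] s : exists e, JL s -> jl s e.
    by have [[_ [e ?]]|] := pselect (JL s); [exists e|exists 0].
  apply: (@countable_jumps _ _ (fun s => quantile mu s - e s) (quantile mu)).
    by move=> s /eP[es _]; rewrite ltrBlDr ltrDl.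
  by move=> s t [/andP[s0 _] _] /eP[_ +] st; apply; rewrite s0.
have cR : countable JR.
  have /choice[e eP] s : exists e, JR s -> jr s e.
    by have [[_ [e ?]]|] := pselect (JR s); [exists e|exists 0].
  apply: (@countable_jumps _ _ (quantile mu) (fun s => quantile mu s + e s)).
    by move=> s /eP[es _]; rewrite ltrDl.
  by move=> s t /eP[_ +] [/andP[_ t1] _] st; apply; rewrite st.
apply: (@sub_countable _ _ _ (JL `|` JR)); last first.
  exact: countableU.
apply: subset_card_le => s [] /=; rewrite in_itv/= => s01 nc.
apply: contrapT => /not_orP[nl nr]; apply: nc; split => //.
have /andP[s0 s1] := s01.
apply/cvgrPdist_lt => e e0.
have [t1 [t1s Qt1]] : exists t, 0 < t < s /\ quantile mu s - e < quantile mu t.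
  apply: contrapT => H; apply: nl; split => //; exists e; split => // t ts.
  by rewrite leNgt; apply/negP => Qt; apply: H; exists t.
have [t2 [t2s Qt2]] : exists t, s < t < 1 /\ quantile mu t < quantile mu s + e.
  apply: contrapT => H; apply: nr; split => //; exists e; split => // t ts.
  by rewrite leNgt; apply/negP => Qt; apply: H; exists t.
have /andP[t10 t1s'] := t1s; have /andP[st2 t21] := t2s.
have : \forall t \near s, t \in `]t1, t2[.
  by apply: near_in_itvoo; rewrite in_itv/= t1s'.
apply: filterS => t; rewrite in_itv/= => /andP[tt1 tt2].
have h1 : quantile mu t1 <= quantile mu t by apply: quantile_nd; lra.
have h2 : quantile mu t <= quantile mu t2 by apply: quantile_nd; lra.
rewrite ltr_norml; apply/andP; split; lra.
Qed.

Lemma measurable_continuity_points :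
  measurable (quantile_continuity_points mu : set (measurableTypeR R)).
Proof.
have -> : quantile_continuity_points mu =
    `]0, 1[%classic `\` (`]0, 1[%classic `\` quantile_continuity_points mu).
  by rewrite setDD setIidr// => s [s01 _]; rewrite /= in_itv.
apply: measurableD; first exact: measurable_itv.
apply: (countable_measurable _ countable_discontinuity) => x.
exact: measurable_set1.
Qed.

Lemma ae01_cocountable (A : set (measurableTypeR R)) (P : R -> Prop) :
  countable A -> (forall s, quantile_continuity_points mu s -> ~ A s -> P s) ->
  {ae leb01, forall s, P s}.
Proof.
move=> cA AP; pose N := A `|` (`]0, 1[%classic `\` quantile_continuity_points mu).
have cN : countable N by exact: countableU cA countable_discontinuity.
have mN : measurable (N : set (measurableTypeR R)).
  by apply: (countable_measurable _ cN) => x; exact: measurable_set1.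
exists (N `|` ~` `]0, 1[%classic); split.
- by apply: measurableU => //; apply: measurableC; exact: measurable_itv.
- rewrite /leb01/= /mrestr setIUl setICl setU0.
  apply/eqP; rewrite eq_le measure_ge0 andbT.
  rewrite -(countable_lebesgue_measure0 cN); apply: le_measure; rewrite ?inE//.
  by apply: measurableI => //; exact: measurable_itv.
- move=> s /= nP; apply: contrapT => /not_orP[/not_orP[nA nD] /contrapT s01].
  by apply: nP; apply: AP => //; apply: contrapT => nc; apply: nD.
Qed.

Lemma countable_atoms : countable [set x | Rminus mu x < Rplus mu x].
Proof.
apply: (@countable_jumps _ _ (Rminus mu) (Rplus mu)) => // x y _ _.
exact: Rplus_le_Rminus.
Qed.

End distribution_functions.

(** * Travel times *)

Section travel.
Context {R : realType}.
Implicit Types (q : R -> R) (u v w x y : R).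

Lemma measurable_inv : measurable_fun [set: R] (@GRing.inv R).
Proof.
have o : open [set x : R | x != 0] by exact: open_neq.
rewrite (_ : [set: R] = [set x : R | x != 0] `|` [set 0]); last first.
  by apply/seteqP; split => // x _; have [->|x0] := eqVneq x 0; [right|left].
apply/measurable_funU; [exact: open_measurable|exact: measurable_set1|split].
- apply: open_continuous_measurable_fun => // x; rewrite inE/= => x0.
  exact: inv_continuous.
- exact: measurable_fun_set1.
Qed.

(** The time needed to cross ]u, v[ at pace q, that is at speed 1 / q. *)
Definition travel q u v : \bar R :=
  (\int[@lebesgue_measure R]_(z in `]u, v[) (q z)%:E)%E.

Section fixed_integrand.
Variable q : R -> R.
Hypothesis mq : measurable_fun [set: R] q.
Hypothesis q0 : forall z, 0 <= q z.

Let mqE (D : set (measurableTypeR R)) : measurable_fun D (EFin \o q).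
Proof. by apply: measurable_funTS; apply/measurable_EFinP; exact: mq. Qed.

Let mI (i : interval R) : measurable ([set` i] : set (measurableTypeR R)).
Proof. exact: measurable_itv. Qed.

Lemma travel_ge0 u v : (0 <= travel q u v)%E.
Proof. by apply: integral_ge0 => z _; rewrite lee_fin. Qed.

Lemma travelxx u : travel q u u = 0%E.
Proof. by rewrite /travel set_itv_ge ?integral_set0// bnd_simp ltxx. Qed.

Lemma travel_split u w v : u <= w <= v ->
  travel q u v = (travel q u w + travel q w v)%E.
Proof.
move=> /andP[]; rewrite le_eqVlt => /predU1P[-> _|uw].
  by rewrite travelxx add0e.
rewrite le_eqVlt => /predU1P[->|wv]; first by rewrite travelxx adde0.
rewrite /travel (@itv_bndbnd_setU _ _ (BRight u) (BRight w) (BLeft v)); last 2 first.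
- by rewrite bnd_simp ltW.
- by rewrite bnd_simp.
rewrite ge0_integral_setU//.
- by congr (_ + _)%E; apply/esym/integral_itv_bndo_bndc; exact: mqE.
- by move=> z _; rewrite lee_fin.
- rewrite disj_set2E; apply/eqP; rewrite -subset0 => z /=.
  by rewrite !in_itv/= => -[/andP[_ h] /andP[/(le_lt_trans h)]]; rewrite ltxx.
Qed.

Lemma travel_sub u v u' v' : u <= u' -> v' <= v ->
  (travel q u' v' <= travel q u v)%E.
Proof.
move=> uu vv; apply: ge0_subset_integral => //.
- by move=> z _; rewrite lee_fin.
- move=> z /=; rewrite !in_itv/= => /andP[uz zv].
  by rewrite (le_lt_trans uu uz) (lt_le_trans zv vv).
Qed.

Let travel_cst (c : R) u v : u <= v ->
  (\int[@lebesgue_measure R]_(z in `]u, v[) c%:E = (c * (v - u))%:E)%E.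
Proof.
move=> uv; have := integral_cst (@lebesgue_measure R) (mI `]u, v[) c%:E.
rewrite /cst => -> /=; rewrite lebesgue_measure_itv/= lte_fin.
case: ltP => [_|vu]; first by rewrite -EFinB -EFinM.
by rewrite (_ : u = v) ?subrr ?mulr0 ?mule0//; apply/le_anti; rewrite uv vu.
Qed.

Lemma le_travel (c : R) u v : u <= v -> 0 <= c ->
  (forall z, u < z < v -> c <= q z) -> ((c * (v - u))%:E <= travel q u v)%E.
Proof.
move=> uv c0 cq; rewrite -travel_cst//; apply: ge0_le_integral => //.
Qed.

Lemma travel_le (c : R) u v : u <= v ->
  (forall z, u < z < v -> q z <= c) -> (travel q u v <= (c * (v - u))%:E)%E.
Proof.
move=> uv cq; rewrite -travel_cst//; apply: ge0_le_integral => //.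
by move=> z _; rewrite lee_fin.
Qed.

(** Monotone convergence along ]u + 1/n, v - 1/n[.  This is how a travel time
    that is infinite at an end point is reached from inside. *)
Lemma travel_inner (M : R) u v : 0 <= M -> (M%:E < travel q u v)%E ->
  exists w1 w2, [/\ u < w1, w1 <= w2, w2 < v & (M%:E < travel q w1 w2)%E].
Proof.
move=> M0; pose F n := `](u + n.+1%:R^-1), (v - n.+1%:R^-1)[%classic : set R.
have n0 n : 0 < (n.+1%:R^-1 : R) by rewrite invr_gt0.
have FE : `]u, v[%classic = \bigcup_n F n.
  apply/seteqP; split=> z; last first.
    move=> [n _]; rewrite /F /= !in_itv/= => /andP[h1 h2].
    rewrite (lt_trans _ h1) ?ltrDl//= (lt_trans h2)// ltrBlDr ltrDl//.
  rewrite /= in_itv/= => /andP[uz zv].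
  pose m := Num.min (z - u) (v - z).
  have m0 : 0 < m by rewrite lt_min !subr_gt0 uz.
  exists (Num.truncn m^-1) => //; rewrite /F/= in_itv/=.
  have : (Num.truncn m^-1).+1%:R^-1 < m.
    by rewrite invf_plt ?posrE ?ltr0n// truncnS_gt.
  rewrite lt_min; move: (_.+1%:R^-1) => e /andP[h1 h2]; apply/andP; split; lra.
rewrite /travel FE => Mlt.
have : (\int[@lebesgue_measure R]_(z in F n) (q z)%:E)%E @[n --> \oo] -->
    (\int[@lebesgue_measure R]_(z in \bigcup_n F n) (q z)%:E)%E.
  apply: ge0_nondecreasing_set_cvg_integral.
  - apply/nondecreasing_seqP => n; apply/subsetPset => z.
    rewrite /F/= !in_itv/= => /andP[h1 h2].
    have : (n.+2%:R^-1 : R) <= n.+1%:R^-1 by rewrite lef_pV2 ?posrE// ler_nat.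
    move: h1 h2; move: (n.+2%:R^-1) (n.+1%:R^-1) => a b h1 h2 h.
    by apply/andP; split; lra.
  - by move=> n; exact: measurable_itv.
  - by move=> n; apply: measurable_funTS; apply/measurable_EFinP.
  - by move=> n z _; rewrite lee_fin.
move/(_ _ (open_nbhs_nbhs (conj (@open_ereal_gt_ereal _ _) Mlt))).
move=> [N _ /(_ _ (leqnn N)) H].
have {}H : (M%:E < \int[@lebesgue_measure R]_(z in F N) (q z)%:E)%E := H.
exists (u + N.+1%:R^-1), (v - N.+1%:R^-1).
split => //; [by rewrite ltrDl| |by rewrite ltrBlDr ltrDl].
rewrite leNgt; apply/negP => h; move: H; rewrite /F set_itv_ge; last first.
  by rewrite bnd_simp -leNgt ltW.
by rewrite integral_set0 lte_fin ltNge M0.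
Qed.

End fixed_integrand.

Lemma travel_add_le q q' (d : R) u v :
  measurable_fun [set: R] q -> measurable_fun [set: R] q' ->
  (forall z, 0 <= q z) -> 0 <= d -> u <= v ->
  (forall z, u < z < v -> q z + d <= q' z) ->
  (travel q u v + (d * (v - u))%:E <= travel q' u v)%E.
Proof.
move=> mq mq' q0 d0 uv qq'.
have mqd : measurable_fun [set: R] (fun z => q z + d).
  by apply: measurable_funD => //; exact: measurable_cst.
rewrite [X in (_ + X)%E](_ : _ = travel (cst d) u v); last first.
  apply/le_anti/andP; split.
    by apply: le_travel => //; exact: measurable_cst.
  by apply: travel_le => //; exact: measurable_cst.
rewrite /travel -ge0_integralD//.
- apply: ge0_le_integral => //.
  + by move=> z _; rewrite adde_ge0// lee_fin.
  + by apply: measurable_funTS; exact: (measurable_EFinP setT _).2 mqd.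
  + by apply: measurable_funTS; apply/measurable_EFinP.
  + by move=> z /=; rewrite in_itv/= lee_fin => /qq'; exact.
- by apply: measurable_funTS; apply/measurable_EFinP.
- by apply/measurable_EFinP; exact: measurable_cst.
Qed.

(** The function is made continuous on the whole line by composition with the
    projection p onto the segment. *)
Lemma lipschitz_IVT (f : R -> R) u v (c K : R) : u <= v -> 0 <= K ->
  (forall x y, u <= x -> x <= y -> y <= v -> `|f x - f y| <= K * (y - x)) ->
  Num.min (f u) (f v) <= c <= Num.max (f u) (f v) ->
  exists2 x, u <= x <= v & f x = c.
Proof.
move=> uv K0 fK cuv; pose p x := Num.max u (Num.min x v).
have p1 x : u <= p x <= v by rewrite le_max lexx/= ge_max uv ge_min lexx orbT.
have pid x : u <= x <= v -> p x = x.
  by move=> /andP[ux xv]; rewrite /p (min_idPl xv) (max_idPr ux).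
have pL x y : x <= y -> p x <= p y /\ p y - p x <= y - x.
  move=> xy; have pm z : Num.min z v <= p z by rewrite le_max lexx orbT.
  have pu z : u <= p z by case/andP: (p1 z).
  have my : Num.min y v <= y by rewrite ge_min lexx.
  have mv : Num.min y v <= v by rewrite ge_min lexx orbT.
  split.
    by rewrite /p ge_max pu /= (le_trans _ (pm y))// le_min !ge_min xy lexx orbT.
  rewrite lerBlDr {1}/p ge_max; apply/andP; split; first by have := pu x; lra.
  have := pm x; case: (leP x v); lra.
have fc : continuous (f \o p).
  move=> x; apply/cvgrPdist_le => e e0.
  exists (e / (K + 1)) => /=; first by rewrite divr_gt0// ltr_wpDl.
  move=> y; rewrite /= => xy.
  have H a b : a <= b -> `|f (p a) - f (p b)| <= K * (b - a).
    move=> ab; have [pab pab'] := pL _ _ ab.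
    have /andP[pa _] := p1 a; have /andP[_ pb] := p1 b.
    by rewrite (le_trans (fK _ _ pa pab pb))// ler_wpM2l.
  have : `|f (p x) - f (p y)| <= K * `|x - y|.
    case: (leP x y) => [xy'|/ltW yx].
      by rewrite [`|x - y|]distrC [`|y - x|]ger0_norm ?subr_ge0// H.
    by rewrite distrC [`|x - y|]ger0_norm ?subr_ge0// H.
  move=> /le_trans; apply; rewrite (le_trans (ler_wpM2l K0 (ltW xy)))//.
  by rewrite mulrCA ger_pMr// ler_pdivrMr ?mul1r ?lerDl// ltr_wpDl.
have [] := @IVT R (f \o p) u v c uv (continuous_subspaceT fc).
  by rewrite /= !pid ?lexx ?uv.
by move=> x; rewrite in_itv/= => xuv <-; exists x => //=; rewrite pid.
Qed.

End travel.

(** * The flow of a single quantile level *)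

Section flow_at_level.
Context {R : realType}.
Variables mu0 nu : probability (measurableTypeR R) R.
Variable Rnu : R -> R.
Hypothesis hRnu : Rnu = Rplus nu \/ Rnu = Rminus nu.
Implicit Types s t x y z : R.

Lemma Rnu_ge x : Rminus nu x <= Rnu x.
Proof. by case: hRnu => ->; rewrite ?Rminus_le_Rplus. Qed.

Lemma Rnu_le x : Rnu x <= Rplus nu x.
Proof. by case: hRnu => ->; rewrite ?Rminus_le_Rplus. Qed.

Lemma Rnu_nd x y : x <= y -> Rnu x <= Rnu y.
Proof. by case: hRnu => ->; [exact: Rplus_nd|exact: Rminus_nd]. Qed.

Lemma Rnu_ge0 x : 0 <= Rnu x.
Proof. exact: le_trans (Rminus_ge0 _ _) (Rnu_ge x). Qed.

Lemma Rnu_le1 x : Rnu x <= 1.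
Proof. exact: le_trans (Rnu_le x) (Rplus_le1 _ _). Qed.

Let D := quantile_continuity_points nu.
Let b s := quantile nu s.
Let a s := quantile mu0 s.

Lemma Rnu_below s x : D s -> x < b s -> Rnu x < s.
Proof.
move=> [s01 _] xb; apply: le_lt_trans (Rnu_le x) _.
exact: Rplus_lt_quantile.
Qed.

(** Strictness here, and not only in [Rnu_below], keeps the trajectories that
    come from above moving until they reach the target. *)
Lemma Rnu_above s x : D s -> b s < x -> s < Rnu x.
Proof.
by move=> Ds bx; apply: lt_le_trans (Rnu_ge x); exact: lt_Rminus_of_continuity Ds bx.
Qed.

Definition speed s x := `|s - Rnu x|.

Lemma speed_gt0 s x : D s -> x != b s -> 0 < speed s x.
Proof.
move=> Ds; rewrite neq_lt normr_gt0 subr_eq0 => /orP[xb|bx].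
- by rewrite gt_eqF// Rnu_below.
- by rewrite lt_eqF// Rnu_above.
Qed.

Lemma speed_le1 s x : D s -> speed s x <= 1.
Proof.
move=> [/andP[s0 s1] _]; have := Rnu_ge0 x; have := Rnu_le1 x.
rewrite /speed ler_norml => h1 h2; apply/andP; split; lra.
Qed.

Definition pace s x := (speed s x)^-1.

Lemma pace_ge0 s x : 0 <= pace s x.
Proof. by rewrite invr_ge0 normr_ge0. Qed.

Lemma measurable_pace s : measurable_fun [set: R] (pace s).
Proof.
apply: (measurableT_comp measurable_inv); apply: measurableT_comp => //.
apply: measurable_funB; first exact: measurable_cst.
by apply: nondecreasing_measurable => // x y; exact: Rnu_nd.
Qed.

(** A trajectory at x can still visit y.  Stating the sequel with [toward] and
    the unsigned [time] treats the motions from below and from above together. *)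
Definition toward s x y := (x <= y <= b s) || (b s <= y <= x).

Definition time s x y : \bar R :=
  travel (pace s) (Num.min x y) (Num.max x y).

Lemma time_ge0 s x y : (0 <= time s x y)%E.
Proof. exact/travel_ge0/pace_ge0. Qed.

Lemma timeC s x y : time s x y = time s y x.
Proof. by rewrite /time minC maxC. Qed.

Lemma time_up s x y : x <= y -> time s x y = travel (pace s) x y.
Proof. by move=> xy; rewrite /time (min_idPl xy) (max_idPr xy). Qed.

Lemma timexx s x : time s x x = 0%E.
Proof. by rewrite time_up// travelxx. Qed.

Lemma toward_total s x y : toward s (a s) x -> toward s (a s) y ->
  toward s x y \/ toward s y x.
Proof.
rewrite /toward => /orP[] /andP[x1 x2] /orP[] /andP[y1 y2].
- by case/orP: (le_total x y) => xy; [left|right]; rewrite xy ?y2 ?x2.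
- by left; rewrite (le_trans x2 y1) (le_trans y2 (le_trans x1 x2)).
- by left; rewrite (le_trans x1 (le_trans x2 y1)) (le_trans y2 x1) orbT.
- by case/orP: (le_total x y) => xy; [right|left]; rewrite xy ?x1 ?y1 orbT.
Qed.

Lemma toward_trans s x y : toward s (a s) x -> toward s x y -> toward s (a s) y.
Proof.
rewrite /toward => /orP[] /andP[x1 x2] /orP[] /andP[y1 y2].
- by rewrite (le_trans x1 y1) y2.
- by rewrite (le_trans x1 (le_trans x2 y1)) (le_trans y2 x2).
- by rewrite (le_trans x1 y1) (le_trans y2 (le_trans x1 x2)) orbT.
- by rewrite y1 (le_trans y2 x2) orbT.
Qed.

Lemma time_split s x y z : toward s x y -> toward s y z ->
  time s x z = (time s x y + time s y z)%E.
Proof.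
have mp := measurable_pace s; have p0 := pace_ge0 s.
move=> xy yz.
have : (x <= y <= z) \/ (z <= y <= x).
  move: xy yz; rewrite /toward => /orP[] /andP[x1 x2] /orP[] /andP[y1 y2].
  - by left; rewrite x1.
  - by left; rewrite x1 (le_trans x2 y1).
  - by right; rewrite x2 (le_trans y2 x1).
  - by right; rewrite x2 y2.
case=> /andP[h1 h2].
- by rewrite !time_up ?(le_trans h1)//; apply: travel_split => //; rewrite h1.
- rewrite [time s x z]timeC [time s x y]timeC [time s y z]timeC addeC.
  rewrite !time_up ?(le_trans h1)//.
  by apply: travel_split => //; rewrite h1.
Qed.

(** Because Rnu is nondecreasing and s - Rnu changes sign at the target. *)
Lemma speed_toward s x y : D s -> toward s x y -> y != b s ->
  speed s y <= speed s x.
Proof.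
move=> Ds + yb; case/orP=> /andP[h1 h2].
- have yb' : y < b s by rewrite lt_neqAle yb.
  rewrite /speed !ger0_norm ?subr_ge0 ?(ltW (Rnu_below Ds _))//.
    by rewrite lerD2l lerN2 Rnu_nd.
  exact: le_lt_trans h1 yb'.
- have by' : b s < y by rewrite lt_neqAle eq_sym yb.
  rewrite /speed !ler0_norm ?subr_le0 ?(ltW (Rnu_above Ds _))//.
    by rewrite !opprB lerD2r Rnu_nd.
  exact: lt_le_trans by' h2.
Qed.

Lemma toward_between s x y z : toward s x y ->
  Num.min x y <= z <= Num.max x y -> toward s x z /\ toward s z y.
Proof.
case/orP=> /andP[h1 h2]; rewrite /toward.
- rewrite (min_idPl h1) (max_idPr h1) => /andP[-> zy].
  by rewrite (le_trans zy h2) zy h2.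
- rewrite (min_idPr h2) (max_idPl h2) => /andP[yz ->].
  by rewrite (le_trans h1 yz) yz h1 !orbT.
Qed.

Lemma toward_b s x : toward s x (b s).
Proof. by rewrite /toward lexx !andbT le_total. Qed.

Lemma toward_stop s y : toward s (b s) y -> y = b s.
Proof. by case/orP=> /andP[h1 h2]; apply/le_anti; rewrite h1 h2. Qed.

Let time_measure s x y (c : R) :
  (0 <= c -> (forall z, Num.min x y < z < Num.max x y -> c <= pace s z) ->
    ((c * `|x - y|)%:E <= time s x y)%E) /\
  ((forall z, Num.min x y < z < Num.max x y -> pace s z <= c) ->
    (time s x y <= (c * `|x - y|)%:E)%E).
Proof.
have mp := measurable_pace s; have p0 := pace_ge0 s.
have -> : `|x - y| = Num.max x y - Num.min x y.
  by case: (leP x y) => xy; [rewrite distrC|]; rewrite ger0_norm// subr_ge0// ltW.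
have mM : Num.min x y <= Num.max x y by case: (leP x y) => // /ltW.
by split=> *; [exact: (le_travel mp)|exact: (travel_le mp)].
Qed.

Lemma le_time s x y : D s -> toward s x y -> x != b s ->
  ((`|x - y| / speed s x)%:E <= time s x y)%E.
Proof.
move=> Ds xy xb; rewrite mulrC; apply: (time_measure _ _ _ _).1.
  exact: pace_ge0.
move=> z /andP[z1 z2]; have zxy : Num.min x y <= z <= Num.max x y by rewrite !ltW.
have [xz zy] := toward_between xy zxy.
have zb : z != b s.
  apply/eqP => zb; rewrite zb in zy z1 z2.
  move: z1 z2; rewrite (toward_stop zy) gt_min lt_max !ltxx !orbF => xb' bx.
  by have := lt_trans xb' bx; rewrite ltxx.
by rewrite lef_pV2 ?posrE ?speed_gt0// speed_toward.
Qed.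

Lemma time_le s x y : D s -> toward s x y -> y != b s ->
  (time s x y <= (`|x - y| / speed s y)%:E)%E.
Proof.
move=> Ds xy yb; rewrite mulrC; apply: (time_measure _ _ _ _).2.
move=> z /andP[z1 z2]; have zxy : Num.min x y <= z <= Num.max x y by rewrite !ltW.
have [xz zy] := toward_between xy zxy.
have zb : z != b s.
  by apply: contraNneq yb => zb; rewrite zb in zy; rewrite (toward_stop zy).
by rewrite lef_pV2 ?posrE ?speed_gt0// speed_toward.
Qed.

(** The speed is at most one; this covers the case where x is the target. *)
Lemma dist_le_time s x y : D s -> toward s x y ->
  (`|x - y|%:E <= time s x y)%E.
Proof.
move=> Ds xy; have [xb|xb] := eqVneq x (b s).
  by rewrite xb in xy *; rewrite (toward_stop xy) subrr normr0 time_ge0.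
apply: le_trans (le_time Ds xy xb); rewrite lee_fin ler_pdivlMr ?speed_gt0//.
by rewrite ler_piMr// speed_le1.
Qed.

(** On the way to the target s - Rnu has a constant sign, so that the oriented
    integral is the unsigned one; the end points form a null set. *)
Lemma PhiE s x : D s -> toward s (a s) x -> Phi mu0 Rnu s x = time s (a s) x.
Proof.
move=> Ds ax; rewrite /Phi -/(a s).
have mR : measurable_fun [set: R] Rnu.
  by apply: nondecreasing_measurable => // y z; exact: Rnu_nd.
have mq : measurable_fun [set: R] (fun z => (s - Rnu z)^-1).
  apply: (measurableT_comp measurable_inv).
  by apply: measurable_funB => //; exact: measurable_cst.
have mqE (E : set (measurableTypeR R)) : measurable_fun E (fun z => ((s - Rnu z)^-1)%:E).
  by apply: measurable_funTS; apply/measurable_EFinP.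
case: (lerP (a s) x) => h.
- rewrite time_up// integral_itv_bndoo; last exact: mqE.
  apply: eq_integral => z.
  rewrite inE/= in_itv/= => /andP[az zx]; congr (_^-1)%:E.
  rewrite /speed ger0_norm// subr_ge0 ltW// Rnu_below//.
  by case/orP: ax => /andP[? ?]; lra.
- rewrite timeC time_up; last exact: ltW.
  rewrite integral_itv_bndoo; last exact: mqE.
  have -> : (\int[@lebesgue_measure R]_(z in `]x, a s[) ((s - Rnu z)^-1)%:E =
      \int[@lebesgue_measure R]_(z in `]x, a s[) (- (pace s z)%:E))%E.
    apply: eq_integral => z; rewrite inE/= in_itv/= => /andP[xz za].
    congr (_%:E); rewrite /pace -invrN /speed ler0_norm ?opprK//.
    rewrite subr_le0 ltW// Rnu_above//.
    by case/orP: ax => /andP[? ?]; lra.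
  by rewrite integral_ge0N ?oppeK// => z _; rewrite lee_fin pace_ge0.
Qed.

Lemma time_fin s x y : D s -> toward s x y -> y != b s ->
  time s x y = (fine (time s x y))%:E.
Proof.
move=> Ds xy yb; rewrite fineK// ge0_fin_numE ?time_ge0//.
by apply: le_lt_trans (time_le Ds xy yb) _; rewrite ltry.
Qed.

(** The total time may be infinite.  Some y before the target takes time more than
    M, and up to y the time is Lipschitz, with constant the pace at y. *)
Lemma time_attained s (M : R) : D s -> 0 <= M ->
  (M%:E < time s (a s) (b s))%E ->
  exists2 x, toward s (a s) x & time s (a s) x = M%:E.
Proof.
move=> Ds M0 Mlt; have mp := measurable_pace s; have p0 := pace_ge0 s.
have [y [ay yb My]] : exists y,
    [/\ toward s (a s) y, y != b s & (M%:E < time s (a s) y)%E].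
  have [w1 [w2 [aw1 w12 w2b Mw]]] := travel_inner mp p0 M0 Mlt.
  case: (leP (a s) (b s)) => [ab|/ltW ba].
  - rewrite (min_idPl ab) (max_idPr ab) in aw1 w2b.
    have aw2 : a s <= w2 by rewrite (le_trans (ltW aw1)).
    exists w2; split.
    + by rewrite /toward aw2 (ltW w2b).
    + by rewrite lt_eqF.
    + by rewrite time_up//; apply: lt_le_trans Mw _; apply: travel_sub => //; exact: ltW.
  - rewrite (min_idPr ba) (max_idPl ba) in aw1 w2b.
    have w1a : w1 <= a s by rewrite (le_trans w12)// ltW.
    exists w1; split.
    + by rewrite /toward w1a (ltW aw1) orbT.
    + by rewrite gt_eqF.
    + rewrite timeC time_up//; apply: lt_le_trans Mw _.
      by apply: travel_sub => //; exact: ltW.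
have sy := speed_gt0 Ds yb.
pose f x := fine (time s (a s) x).
have betw x : Num.min (a s) y <= x <= Num.max (a s) y ->
    [/\ toward s (a s) x, toward s x y & x != b s].
  move=> /(toward_between ay)[ax xy]; split => //.
  by apply: contraNneq yb => xb; rewrite xb in xy; rewrite (toward_stop xy).
have fL x z : toward s (a s) x -> toward s x z -> toward s z y -> z != b s ->
    `|f x - f z| <= (speed s y)^-1 * `|x - z|.
  move=> ax xz zy zb; have az := toward_trans ax xz.
  have xb : x != b s.
    by apply: contraNneq zb => xb; rewrite xb in xz; rewrite (toward_stop xz).
  have := time_split ax xz; rewrite (time_fin Ds az zb) (time_fin Ds ax xb).
  rewrite (time_fin Ds xz zb) -EFinD => -[]; rewrite -/(f x) -/(f z) => ->.
  rewrite opprD addrA subrr sub0r normrN ger0_norm ?fine_ge0 ?time_ge0//.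
  rewrite -lee_fin -(time_fin Ds xz zb); apply: le_trans (time_le Ds xz zb) _.
  rewrite lee_fin mulrC ler_wpM2r// lef_pV2 ?posrE ?speed_gt0//.
  exact: speed_toward.
have [] := @lipschitz_IVT R f (Num.min (a s) y) (Num.max (a s) y) M (speed s y)^-1.
- by case: (leP (a s) y) => // /ltW.
- by rewrite invr_ge0 ltW.
- move=> x z mx xz zM.
  have [ax xy xb] : [/\ toward s (a s) x, toward s x y & x != b s].
    by apply: betw; rewrite mx (le_trans xz).
  have [az zy zb] : [/\ toward s (a s) z, toward s z y & z != b s].
    by apply: betw; rewrite zM (le_trans mx).
  rewrite -[z - x]ger0_norm ?subr_ge0// [`|z - x|]distrC.
  have [h|h] := toward_total ax az; first exact: fL.
  by rewrite [`|f x - _|]distrC [`|x - _|]distrC; exact: fL.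
- have fa : f (a s) = 0 by rewrite /f timexx.
  have fy : M <= f y by rewrite -lee_fin -(time_fin Ds ay yb) ltW.
  case: (leP (a s) y) => _; rewrite fa ge_min le_max ?M0 ?fy/= ?orbT//.
- move=> x xy fx; have [ax _ xb] := betw _ xy; exists x => //.
  by rewrite (time_fin Ds ax xb) -/(f x) fx.
Qed.

Lemma Phi_domE s x : Phi_dom mu0 nu s x = toward s (a s) x.
Proof.
rewrite /Phi_dom /= in_itv/= /toward -/(a s) -/(b s).
congr is_true; apply/idP/idP; case: (leP (a s) (b s)) => ab.
- by move=> ->.
- by move=> ->; rewrite orbT.
- by case/orP=> // /andP[bx xa]; rewrite (le_trans ab bx) (le_trans xa ab).
- case/orP=> // /andP[ax xb]; have := le_lt_trans (le_trans ax xb) ab.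
  by rewrite ltxx.
Qed.

Lemma lte_half (t : R) (T : \bar R) :
  (t%:E < (2^-1)%:E * T)%E = ((2 * t)%:E < T)%E.
Proof.
case: T => [r| |].
- by rewrite -EFinM !lte_fin; apply/idP/idP; lra.
- by rewrite gt0_muley ?lte_fin// !ltry.
- by rewrite gt0_muleNy ?lte_fin.
Qed.

(** The two branches of the definition: the trajectory either has reached its
    target or sits at a point that takes time [2 * t] to reach.  All the other
    properties of the flow are derived from this description. *)
Lemma flow_atP s t (x := flow_at mu0 nu Rnu s t) : D s -> 0 <= t ->
  toward s (a s) x /\
  (x = b s /\ (time s (a s) (b s) <= (2 * t)%:E)%E \/
   x != b s /\ time s (a s) x = (2 * t)%:E).
Proof.
move=> Ds t0; rewrite /x /flow_at /hitting_time PhiE//; last exact: toward_b.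
rewrite lte_half; case: ltP => h; last by split; [exact: toward_b|left].
have t20 : 0 <= 2 * t by rewrite mulr_ge0.
have [z az tz] := time_attained Ds t20 h.
have im : (2 * t)%:E \in Phi mu0 Rnu s @` Phi_dom mu0 nu s.
  by rewrite inE; exists z; rewrite ?Phi_domE// PhiE.
have E := pinvK (fun=> 0) im.
have dom : toward s (a s)
    ('pinv_(fun=> 0) (Phi_dom mu0 nu s) (Phi mu0 Rnu s) (2 * t)%:E).
  rewrite -Phi_domE; apply: (@surjpinv_image_sub _ _ (fun=> 0) _
    (Phi mu0 Rnu s @` Phi_dom mu0 nu s) (Phi mu0 Rnu s)) => //.
  by exists (2 * t)%:E => //; rewrite inE in im.
split=> //; right; split; last by rewrite -PhiE.
apply/eqP => xb; rewrite xb in E; move: h; rewrite -E PhiE ?ltxx//; exact: toward_b.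
Qed.

Let g s t := flow_at mu0 nu Rnu s t.

Lemma flow_at_toward s t : D s -> 0 <= t -> toward s (a s) (g s t).
Proof. by move=> Ds t0; have [] := flow_atP Ds t0. Qed.

Lemma time_flow_le s t : D s -> 0 <= t -> (time s (a s) (g s t) <= (2 * t)%:E)%E.
Proof. by move=> Ds t0; rewrite /g; have [_ [[-> ?]|[_ ->]]] := flow_atP Ds t0. Qed.

Lemma time_flow s t : D s -> 0 <= t -> g s t != b s ->
  time s (a s) (g s t) = (2 * t)%:E.
Proof.
by move=> Ds t0; rewrite /g; have [_ [[-> _]|[_ ->]]] := flow_atP Ds t0; rewrite ?eqxx.
Qed.

Lemma flow_at0 s : D s -> g s 0 = a s.
Proof.
move=> Ds; have := time_flow_le Ds (lexx 0).
have := dist_le_time Ds (flow_at_toward Ds (lexx 0)).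
move=> /le_trans /[apply]; rewrite mulr0 lee_fin normr_le0 subr_eq0.
by move=> /eqP.
Qed.

Lemma flow_at_frozen s t : D s -> 0 <= t ->
  (time s (a s) (b s) <= (2 * t)%:E)%E -> g s t = b s.
Proof.
move=> Ds t0 T; apply/eqP; apply: contraT => gb.
have := T; rewrite (time_split (flow_at_toward Ds t0) (toward_b _ _)).
rewrite time_flow// -leeBrDl// subee// => h.
have := le_trans (dist_le_time Ds (toward_b _ _)) h.
by rewrite lee_fin normr_le0 subr_eq0 (negbTE gb).
Qed.

Lemma flow_at_order s t t' : D s -> 0 <= t -> t <= t' ->
  toward s (g s t) (g s t').
Proof.
move=> Ds t0 tt'; have t'0 := le_trans t0 tt'.
have [//|yx] := toward_total (flow_at_toward Ds t0) (flow_at_toward Ds t'0).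
have [yb|yb] := eqVneq (g s t') (b s); first by rewrite yb toward_b.
suff -> : g s t' = g s t by rewrite /toward lexx !andbT/= le_total.
have := time_flow_le Ds t0.
rewrite (time_split (flow_at_toward Ds t'0) yx) time_flow// -leeBrDl//.
move=> /(le_trans (dist_le_time Ds yx)); rewrite -EFinB lee_fin => h.
have : `|g s t' - g s t| <= 0 by lra.
by rewrite normr_le0 subr_eq0 => /eqP.
Qed.

(** Half of the derivative of a trajectory at x.  At the target it is 0 even if
    s - Rnu is not, which happens when the target is an atom. *)
Definition velocity s x := if x == b s then 0 else s - Rnu x.

Lemma normr_velocity s x : `|velocity s x| = if x == b s then 0 else speed s x.
Proof. by rewrite /velocity; case: ifP; rewrite ?normr0. Qed.

Lemma velocity_ge0 s x : D s -> x <= b s -> 0 <= velocity s x.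
Proof.
move=> Ds; rewrite le_eqVlt /velocity; case: eqP => //= _ xb.
by rewrite subr_ge0 ltW// Rnu_below.
Qed.

Lemma velocity_le0 s x : D s -> b s <= x -> velocity s x <= 0.
Proof.
move=> Ds; rewrite le_eqVlt eq_sym /velocity; case: eqP => //= _ xb.
by rewrite subr_le0 ltW// Rnu_above.
Qed.

Lemma velocity_le1 s x : D s -> `|velocity s x| <= 1.
Proof. by move=> Ds; rewrite normr_velocity; case: ifP => // _; exact: speed_le1. Qed.

Let flow_dist s t t' (x := g s t) (y := g s t') : D s -> 0 <= t -> t <= t' ->
  2 * `|velocity s y| * (t' - t) <= `|x - y| <= 2 * `|velocity s x| * (t' - t).
Proof.
move=> Ds t0 tt'; have t'0 := le_trans t0 tt'; have xy := flow_at_order Ds t0 tt'.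
rewrite !normr_velocity; have [xb|xb] := eqVneq x (b s).
  have yb : y = b s by rewrite -/x xb in xy; exact: toward_stop xy.
  by rewrite yb eqxx xb subrr normr0 !mulr0 !mul0r lexx.
have tx := time_flow Ds t0 xb; have := time_split (flow_at_toward Ds t0) xy.
rewrite tx -/x -/y => E; have sx := speed_gt0 Ds xb; apply/andP; split.
- case: eqVneq => yb; first by rewrite mulr0 mul0r.
  have sy := speed_gt0 Ds yb.
  have := time_le Ds xy yb; rewrite time_fin// lee_fin ler_pdivlMr//.
  move: E; rewrite time_flow// -/x -/y (time_fin Ds xy yb) -EFinD => -[]; nra.
- have := le_time Ds xy xb; have := time_flow_le Ds t'0; rewrite E.
  rewrite -leeBrDl// -EFinB => /[swap] /le_trans /[apply].
  rewrite lee_fin ler_pdivrMr//; nra.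
Qed.

Lemma flow_at_lipschitz s t t' : D s -> 0 <= t -> 0 <= t' ->
  `|g s t - g s t'| <= 2 * `|t - t'|.
Proof.
move=> Ds; wlog : t t' / t <= t' => [H t0 t'0|tt' t0 _].
  case/orP: (le_total t t') => h; first exact: H.
  by rewrite distrC [`|t - _|]distrC; exact: H.
have /andP[_] := flow_dist Ds t0 tt'; move=> /le_trans; apply.
rewrite [`|t - t'|]distrC [`|t' - t|]ger0_norm ?subr_ge0// ler_wpM2r ?subr_ge0//.
by rewrite ler_piMr// velocity_le1.
Qed.

(** The slope of the trajectory between two times lies between the derivatives at
    the two end points, because the speed decreases on the way to the target. *)
Lemma flow_at_increment s t t' : D s -> 0 <= t -> 0 <= t' ->
  `|g s t' - g s t - 2 * velocity s (g s t) * (t' - t)| <=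
    2 * `|velocity s (g s t') - velocity s (g s t)| * `|t' - t|.
Proof.
move=> Ds t0 t'0.
have slope r r' (p := 2 * velocity s (g s r) * (r' - r))
    (q := 2 * velocity s (g s r') * (r' - r)) : 0 <= r -> r <= r' ->
    q <= g s r' - g s r <= p \/ p <= g s r' - g s r <= q.
  move=> r0 rr'; have := flow_dist Ds r0 rr'; have := flow_at_order Ds r0 rr'.
  case/orP=> /andP[h1 h2].
  - rewrite (ger0_norm (velocity_ge0 Ds h2)) (ger0_norm (velocity_ge0 Ds (le_trans h1 h2))).
    by rewrite distrC ger0_norm ?subr_ge0//; left.
  - rewrite (ler0_norm (velocity_le0 Ds h1)) (ler0_norm (velocity_le0 Ds (le_trans h1 h2))).
    rewrite ger0_norm ?subr_ge0// => /andP[u1 u2]; right.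
    by apply/andP; rewrite /p /q; split; lra.
have E c : 2 * `|c| * `|t' - t| = `|2 * c * (t' - t)|.
  by rewrite !normrM [`|2|]ger0_norm.
rewrite E [2 * (_ - _)]mulrBr [(_ - _) * (t' - t)]mulrBl.
case/orP: (le_total t t') => tt'.
- move: (slope _ _ t0 tt').
  move: (2 * velocity s (g s t) * (t' - t))
    (2 * velocity s (g s t') * (t' - t)) (g s t' - g s t).
  by move=> p q d [] /andP[h1 h2]; [rewrite !ler0_norm|rewrite !ger0_norm]; lra.
- move: (slope _ _ t'0 tt').
  rewrite -(opprB t' t) -(opprB (g s t') (g s t)) !mulrN !lerN2.
  move: (2 * velocity s (g s t) * (t' - t))
    (2 * velocity s (g s t') * (t' - t)) (g s t' - g s t).
  by move=> p q d [] /andP[h1 h2]; [rewrite !ler0_norm|rewrite !ger0_norm]; lra.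
Qed.

(** At a point that is not an atom the two distribution functions are squeezed
    together. *)
Lemma Rnu_continuous x : Rminus nu x = Rplus nu x -> forall e, 0 < e ->
  exists2 d, 0 < d & forall y, `|y - x| < d -> `|Rnu y - Rnu x| <= e.
Proof.
move=> atom e e0; have Rx : Rnu x = Rplus nu x.
  by apply/le_anti; rewrite Rnu_le -atom Rnu_ge.
have [y1 xy1 Ry1] : exists2 y, x < y & Rplus nu y < Rplus nu x + e.
  by apply: Rplus_right_lt; rewrite ltrDl.
have [y2 y2x Ry2] : exists2 y, y < x & Rminus nu x - e < Rplus nu y.
  by apply: Rminus_left_gt; rewrite ltrBlDr ltrDl.
exists (Num.min (y1 - x) (x - y2)); first by rewrite lt_min !subr_gt0 xy1.
move=> y; rewrite lt_min !ltr_norml => /andP[/andP[h1 h2] /andP[h3 h4]].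
have yy1 : y < y1 by lra.
have y2y : y2 < y by lra.
have := Rnu_le y; have := Rnu_ge y; have := Rplus_nd nu (ltW yy1).
have := Rplus_le_Rminus nu y2y; rewrite Rx ler_norml => ? ? ? ?.
by apply/andP; split; lra.
Qed.

(** It suffices that the velocity along the trajectory be continuous at t.  It is
    if the current position is not an atom; otherwise the hypothesis says that
    the target has been reached strictly before t, and the trajectory is constant
    around t. *)
Lemma flow_at_derive s t : D s -> 0 < t ->
  Rminus nu (g s t) = Rplus nu (g s t) \/
    time s (a s) (g s t) != (2 * t)%:E ->
  is_derive t 1 (g s) (2 * velocity s (g s t)).
Proof.
move=> Ds t0 good; have t0' := ltW t0.
have vc : forall e, 0 < e -> exists2 d, 0 < d & forall t', `|t' - t| < d ->
    0 <= t' /\ `|velocity s (g s t') - velocity s (g s t)| <= e.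
  move=> e e0; case: good => [atom|ne].
  - have [d d0 H] := Rnu_continuous atom e0.
    have [d' d'0 H'] : exists2 d', 0 < d' & forall y, `|y - g s t| < d' ->
        `|velocity s y - velocity s (g s t)| <= e.
      have [xb|xb] := eqVneq (g s t) (b s).
      + have sR : Rnu (g s t) = s.
          apply/le_anti; have [s01 _] := Ds.
          rewrite (le_trans (Rnu_le _))/=; last by rewrite -atom xb Rminus_quantile.
          by rewrite (le_trans _ (Rnu_ge _))// atom xb Rplus_quantile.
        exists d => // y yd; rewrite /velocity xb eqxx subr0.
        case: ifP => _; first by rewrite normr0 ltW.
        by rewrite -{1}sR distrC; exact: H.
      + exists (Num.min d `|g s t - b s|).
          by rewrite lt_min d0 normr_gt0 subr_eq0.
        move=> y; rewrite lt_min => /andP[yd yb]; rewrite /velocity (negbTE xb).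
        rewrite ifF; last by apply/eqP => E; move: yb; rewrite E distrC ltxx.
        have -> : s - Rnu y - (s - Rnu (g s t)) = - (Rnu y - Rnu (g s t)) by lra.
        by rewrite normrN; exact: H.
    exists (Num.min t (d' / 2)); first by rewrite lt_min t0 divr_gt0.
    move=> t'; rewrite lt_min => /andP[h1 h2].
    have t'0 : 0 <= t' by move: h1; rewrite ltr_norml => /andP[? _]; lra.
    split=> //; apply: H'; apply: le_lt_trans (flow_at_lipschitz Ds t'0 t0') _.
    by rewrite mulrC -ltr_pdivlMr.
  - have xb : g s t = b s.
      by apply/eqP; apply: contraNT ne => xb; rewrite time_flow.
    have := time_flow_le Ds t0'; rewrite le_eqVlt (negbTE ne)/= xb.
    have := time_ge0 s (a s) (b s); case E : (time s (a s) (b s)) => [T| |]// _.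
    rewrite lte_fin => Tt; exists (Num.min t (t - T / 2)).
      by rewrite lt_min t0; lra.
    move=> t'; rewrite lt_min !ltr_norml => /andP[/andP[h1 h2] /andP[h3 h4]].
    have t'0 : 0 <= t' by lra.
    have -> : g s t' = b s by apply: flow_at_frozen => //; rewrite E lee_fin; lra.
    by rewrite subrr normr0; split=> //; exact: ltW.
apply: littleo_is_derive => e e0.
have e2 : 0 < e / 2 by rewrite divr_gt0.
have [d d0 H] := vc _ e2.
exists d => // h hd; have [] := H (t + h); first by rewrite addrAC subrr add0r.
move=> th0 vh; have := flow_at_increment Ds t0' th0.
rewrite [t + h - t]addrAC subrr add0r [h * _]mulrC => /le_trans; apply.
by rewrite ler_wpM2r// mulrC -ler_pdivlMr.
Qed.

Lemma inv_gap (x y : R) : 0 < x -> x <= y -> y <= 1 -> y^-1 + (y - x) <= x^-1.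
Proof.
move=> x0 xy y1; have y0 := lt_le_trans x0 xy.
rewrite -(ler_pM2r (mulr_gt0 x0 y0)) mulrDl.
rewrite [y^-1 * _]mulrCA mulVf ?gt_eqF// mulr1 [x^-1 * _]mulrA mulVf ?gt_eqF// mul1r.
have : x * y <= 1 by nra.
nra.
Qed.

(** A higher level is faster on the way up and slower on the way down.  The paces
    differ by at least the difference of the levels because the speeds are at
    most one. *)
Lemma time_up_gap s1 s2 x y : D s1 -> D s2 -> s1 <= s2 -> x <= y -> y <= b s1 ->
  (time s2 x y + ((s2 - s1) * (y - x))%:E <= time s1 x y)%E.
Proof.
move=> D1 D2 s12 xy yb; rewrite !time_up//; apply: travel_add_le => //.
- exact: measurable_pace.
- exact: measurable_pace.
- exact: pace_ge0.
- by rewrite subr_ge0.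
- move=> z /andP[_ zy]; have zb := lt_le_trans zy yb.
  have R1 := Rnu_below D1 zb; have := Rnu_ge0 z; have [/andP[_ s2lt1] _] := D2.
  move=> R0; rewrite /pace /speed !ger0_norm ?subr_ge0; [|lra|lra].
  rewrite (_ : s2 - s1 = s2 - Rnu z - (s1 - Rnu z)); last lra.
  by apply: inv_gap; lra.
Qed.

Lemma time_down_gap s1 s2 x y : D s1 -> D s2 -> s1 <= s2 -> y <= x -> b s2 <= y ->
  (time s1 x y + ((s2 - s1) * (x - y))%:E <= time s2 x y)%E.
Proof.
move=> D1 D2 s12 yx by_; rewrite ![time _ x y]timeC !time_up//.
apply: travel_add_le => //.
- exact: measurable_pace.
- exact: measurable_pace.
- exact: pace_ge0.
- by rewrite subr_ge0.
- move=> z /andP[yz _]; have bz := le_lt_trans by_ yz.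
  have R2 := Rnu_above D2 bz; have := Rnu_le1 z; have [/andP[s1gt0 _] _] := D1.
  move=> R1; rewrite /pace /speed !ler0_norm ?subr_le0; [|lra|lra].
  rewrite !opprB (_ : s2 - s1 = Rnu z - s1 - (Rnu z - s2)); last lra.
  by apply: inv_gap; lra.
Qed.

Let a_nd s1 s2 : D s1 -> D s2 -> s1 <= s2 -> a s1 <= a s2.
Proof. by move=> [D1 _] [D2 _]; exact: quantile_nd. Qed.

Let b_nd s1 s2 : D s1 -> D s2 -> s1 <= s2 -> b s1 <= b s2.
Proof. by move=> [D1 _] [D2 _]; exact: quantile_nd. Qed.

(** The higher level also starts higher, hence with a shorter way up. *)
Lemma arrival_up s1 s2 y : D s1 -> D s2 -> s1 <= s2 ->
  a s2 <= y -> y <= b s1 ->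
  (time s2 (a s2) y + ((s2 - s1) * (y - a s2))%:E <= time s1 (a s1) y)%E.
Proof.
move=> D1 D2 s12 ay yb; have a12 := a_nd D1 D2 s12.
apply: le_trans (time_up_gap D1 D2 s12 ay yb) _.
rewrite !time_up ?(le_trans a12)//.
by apply: travel_sub => //; [exact: measurable_pace|exact: pace_ge0].
Qed.

Lemma arrival_down s1 s2 y : D s1 -> D s2 -> s1 <= s2 ->
  y <= a s1 -> b s2 <= y ->
  (time s1 (a s1) y + ((s2 - s1) * (a s1 - y))%:E <= time s2 (a s2) y)%E.
Proof.
move=> D1 D2 s12 ya by_; have a12 := a_nd D1 D2 s12.
apply: le_trans (time_down_gap D1 D2 s12 ya by_) _.
rewrite ![time s2 _ y]timeC !time_up ?(le_trans ya)//.
by apply: travel_sub => //; [exact: measurable_pace|exact: pace_ge0].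
Qed.

(** Suppose that the higher level is strictly below.  If both levels move up, the
    higher one reaches the position of the lower one no later than the latter,
    hence by time t; if both move down, the lower one has likewise reached the
    position of the higher one.  Both cases are excluded by [late]; if the
    directions differ the order is that of the initial values or of the
    targets. *)
Lemma flow_at_nd s1 s2 t : D s1 -> D s2 -> 0 <= t -> s1 <= s2 -> g s1 t <= g s2 t.
Proof.
move=> D1 D2 t0 s12; rewrite leNgt; apply/negP => gg.
have a12 := a_nd D1 D2 s12; have b12 := b_nd D1 D2 s12.
have T1 := time_flow_le D1 t0; have T2 := time_flow_le D2 t0.
have w1 := flow_at_toward D1 t0; have w2 := flow_at_toward D2 t0.
have late s x y : D s -> toward s (a s) x -> toward s x y -> x != y ->
    time s (a s) x = (2 * t)%:E -> (time s (a s) y <= (2 * t)%:E)%E -> False.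
  move=> Ds ax xy xney tx; rewrite (time_split ax xy) tx -leeBrDl// subee//.
  move=> /(le_trans (dist_le_time Ds xy)); rewrite lee_fin normr_le0 subr_eq0.
  by rewrite (negbTE xney).
have gap : 0 <= s2 - s1 by rewrite subr_ge0.
case/orP: (w1) => /andP[h1 h2]; case/orP: (w2) => /andP[h3 h4].
- have ay : a s2 <= g s1 t by rewrite (le_trans h3)// ltW.
  have yb : g s1 t <= b s2 by rewrite (le_trans h2).
  apply: (late s2 (g s2 t) (g s1 t)) => //.
  + by rewrite /toward (ltW gg) yb.
  + by rewrite lt_eqF.
  + by apply: time_flow => //; rewrite lt_eqF// (lt_le_trans gg).
  + apply: le_trans T1; apply: le_trans (arrival_up D1 D2 s12 ay h2).
    by rewrite leeDl// lee_fin mulr_ge0// subr_ge0.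
- have := le_lt_trans (le_trans b12 h3) gg; rewrite ltNge => /negP; apply.
  exact: h2.
- have := le_lt_trans (le_trans a12 h3) gg; rewrite ltNge => /negP; apply.
  exact: h2.
- have ya : g s2 t <= a s1 by rewrite (le_trans (ltW gg)).
  have by_ : b s1 <= g s2 t by rewrite (le_trans b12).
  apply: (late s1 (g s1 t) (g s2 t)) => //.
  + by rewrite /toward (ltW gg) by_ orbT.
  + by rewrite gt_eqF.
  + by apply: time_flow => //; rewrite gt_eqF// (le_lt_trans by_).
  + apply: le_trans T2; apply: le_trans (arrival_down D1 D2 s12 ya h3).
    by rewrite leeDl// lee_fin mulr_ge0// subr_ge0.
Qed.

(** Two levels moving in the same direction do not reach a point at the same
    positive time, by the gap in [arrival_up] and [arrival_down]; so each atom
    is responsible for at most two levels. *)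
Lemma countable_atom_passing t : 0 < t -> countable
  [set s | [/\ D s, Rminus nu (g s t) != Rplus nu (g s t) &
    time s (a s) (g s t) = (2 * t)%:E]].
Proof.
move=> t0; set S := (X in countable X); have t0' := ltW t0.
have moved s : S s -> g s t != a s.
  move=> [Ds _ T]; apply/eqP => E; move: T; rewrite E timexx => -[]; lra.
have inj (U : set R) : U `<=` S -> (forall s1 s2, U s1 -> U s2 -> s1 < s2 ->
    g s1 t != g s2 t) -> countable U.
  move=> US Uinj; have /countable_injP[f finj] := countable_atoms nu.
  apply/countable_injP; exists (fun s => f (g s t)) => s1 s2 /set_mem U1 /set_mem U2.
  have atom s : U s -> g s t \in [set x | Rminus nu x < Rplus nu x].
    move=> /US[_ ne _]; rewrite inE/= lt_neqAle ne.
    exact: Rminus_le_Rplus.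
  move=> /(finj _ _ (atom _ U1) (atom _ U2)) E.
  have [s12|s21|//] := ltgtP s1 s2.
  - by have := Uinj _ _ U1 U2 s12; rewrite E eqxx.
  - by have := Uinj _ _ U2 U1 s21; rewrite E eqxx.
have -> : S = (S `&` [set s | a s < g s t <= b s]) `|`
    (S `&` [set s | b s <= g s t < a s]).
  apply/seteqP; split=> s; last by case=> -[].
  move=> Ss; have [Ds _ _] := Ss; have ne := moved _ Ss.
  case/orP: (flow_at_toward Ds t0') => /andP[h1 h2]; [left|right]; split=> //=.
  - by rewrite h2 lt_neqAle eq_sym ne h1.
  - by rewrite h1 lt_neqAle ne h2.
apply: countableU; apply: inj; try by move=> s [].
- move=> s1 s2 [[D1 _ T1] /andP[u1 v1]] [[D2 _ T2] /andP[u2 v2]] s12.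
  apply/eqP => E; rewrite E in T1 u1 v1.
  have := arrival_up D1 D2 (ltW s12) (ltW u2) v1; rewrite T1 T2 -EFinD lee_fin.
  by rewrite gerDl leNgt mulr_gt0// subr_gt0.
- move=> s1 s2 [[D1 _ T1] /andP[u1 v1]] [[D2 _ T2] /andP[u2 v2]] s12.
  apply/eqP => E; rewrite E in T1 u1 v1.
  have := arrival_down D1 D2 (ltW s12) (ltW v1) u2; rewrite T1 T2 -EFinD lee_fin.
  by rewrite gerDl leNgt mulr_gt0// subr_gt0.
Qed.

End flow_at_level.

(** * Subgradients of the energy *)

Section integrable01.
Context {R : realType}.
Implicit Types f u w : R -> R.

Definition L1 f := (@leb01 R).-integrable setT (EFin \o f).

Lemma L2_L1 u : L2 u -> L1 u.
Proof.
move=> Lu; apply/Lfun1_integrable; apply: Lfun_subset12 => //.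
by rewrite -/leb01 [X in X \is a fin_num](_ : _ = 1%E)//; exact: leb01_setT.
Qed.

Lemma L2M_L1 u w : L2 u -> L2 w -> L1 (fun s => u s * w s).
Proof. by move=> Lu Lw; apply/Lfun1_integrable; exact: (Lfun2_mul_Lfun1 Lu Lw). Qed.

Lemma L1D f f' : L1 f -> L1 f' -> L1 (fun s => f s + f' s).
Proof. by move=> lf lf'; exact: (integrableD measurableT lf lf'). Qed.

Lemma L1_measurable f : L1 f -> measurable_fun [set: R] f.
Proof. by move=> /integrableP[mf _]; exact/measurable_EFinP. Qed.

(** The smaller function is replaced by the minimum of both, to which it is equal
    almost everywhere. *)
Lemma ae_le_Rintegral01 f f' : L1 f -> L1 f' ->
  {ae leb01, forall s, f s <= f' s} ->
  \int[leb01]_s f s <= \int[leb01]_s f' s.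
Proof.
move=> lf lf' ff'; pose m s := Num.min (f s) (f' s).
have mm : measurable_fun [set: R] m.
  by apply: measurable_minr; exact: L1_measurable.
have lm : L1 m.
  have la : L1 (fun s => `|f s| + `|f' s|).
    by apply: L1D; [exact: (integrable_abse lf)|exact: (integrable_abse lf')].
  apply: le_integrable la => //; first by apply/measurable_EFinP.
  move=> s _ /=; rewrite lee_fin [leRHS]ger0_norm ?addr_ge0//.
  by rewrite /m; case: (leP (f s)) => _; rewrite ?lerDl ?lerDr.
rewrite [leLHS](_ : _ = \int[leb01]_s m s).
  by apply: le_Rintegral => // s _; rewrite /m ge_min lexx orbT.
congr fine; apply: ae_eq_integral => //.
- by apply/measurable_EFinP; exact: L1_measurable.
- by apply/measurable_EFinP.
- apply: (@filterS _ _ (ae_filter_ringOfSetsType leb01) _ _ _ ff') => s ffs _ /=.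
  by rewrite /m (min_idPl ffs).
Qed.

End integrable01.

Section energy.
Context {R : realType}.
Variable nu : probability (measurableTypeR R) R.
Hypothesis hnu : finite_second_moment nu.
Implicit Types (x w c : R) (u xi : R -> R).

Definition mean_dist x : R := \int[leb01]_t `|x - quantile nu t|.

Lemma L1_norm (f : R -> R) : L1 f -> L1 (fun s => `|f s|).
Proof. by move=> lf; exact: (integrable_abse lf). Qed.

Lemma L1_cst c : L1 (fun _ : R => c).
Proof. exact: L2_L1 (L2_cst c). Qed.

Lemma Rintegral01_cst c : \int[@leb01 R]_s c = c.
Proof. by rewrite /Rintegral integral01_cst. Qed.

Let dist_L1 x : L1 (fun t => `|x - quantile nu t|).
Proof.
by apply: L1_norm; apply: L2_L1; exact: (L2B (L2_cst x) (quantile_L2 hnu)).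
Qed.

(* The line through x with slope 1 for the t in A and -1 for the others supports
   w |-> |w - quantile nu t| at x. *)
Let support_line (A : set (measurableTypeR R)) x w : measurable A ->
  (forall t, A t -> quantile nu t <= x) ->
  (forall t, ~ A t -> x <= quantile nu t) ->
  mean_dist x + (2 * fine (leb01 A) - 1) * (w - x) <= mean_dist w.
Proof.
move=> mA Ax nAx.
have indL1 : L1 (\1_A : R -> R).
  apply: L2_L1; apply: (@L2_bounded _ _ 1); first exact: measurable_indic.
  by move=> t; rewrite indicE normr_nat; case: (t \in A); rewrite ?ler01.
have i1 : L1 (fun t => 2 * (w - x) * \1_A t).
  exact: (integrableZl measurableT (2 * (w - x)) indL1).
have i2 : L1 (fun t => 2 * (w - x) * \1_A t + - (w - x)).
  exact: L1D i1 (L1_cst _).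
have -> : mean_dist x + (2 * fine (leb01 A) - 1) * (w - x) =
    \int[leb01]_t (`|x - quantile nu t| + (2 * (w - x) * \1_A t + - (w - x))).
  rewrite (RintegralD measurableT (dist_L1 x) i2).
  rewrite (RintegralD measurableT i1 (L1_cst (- (w - x)))).
  rewrite (RintegralZl _ measurableT indL1) Rintegral01_cst -/(mean_dist x); congr (_ + _).
  have -> : \int[leb01]_t (\1_A t : R) = fine (leb01 A).
    by rewrite /Rintegral integral_indic// setIT.
  by ring.
apply: le_Rintegral; [by []|exact: L1D|exact: dist_L1|].
move=> t _; rewrite indicE; case: (boolP (t \in A)) => tA; rewrite ?mulr1 ?mulr0.
- rewrite inE in tA; have qx := Ax _ tA; rewrite [`|x - _|]ger0_norm ?subr_ge0//.
  have := ler_norm (w - quantile nu t); lra.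
- rewrite notin_setE in tA; have qx := nAx _ tA.
  rewrite [`|x - _|]ler0_norm ?subr_le0//.
  have := ler_norm (- (w - quantile nu t)); rewrite normrN; lra.
Qed.

(** The extreme slopes come from counting the quantiles equal to x as lying below
    x or not; which one is needed depends on the sign of w - x. *)
Lemma mean_dist_subgradient x w c :
  2 * Rminus nu x - 1 <= c <= 2 * Rplus nu x - 1 ->
  mean_dist x + c * (w - x) <= mean_dist w.
Proof.
move=> /andP[c1 c2]; have mQ := measurable_quantile nu.
have mA (i : interval R) : measurable (quantile nu @^-1` [set` i] : set (measurableTypeR R)).
  by rewrite -[X in measurable X]setTI; apply: mQ => //; exact: measurable_itv.
case: (leP x w) => [xw|/ltW wx].
- have le_x t : (quantile nu @^-1` `]-oo, x]) t -> quantile nu t <= x.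
    by rewrite /= in_itv.
  have nle_x t : ~ (quantile nu @^-1` `]-oo, x]) t -> x <= quantile nu t.
    by rewrite /= in_itv/= => /negP; rewrite -ltNge => /ltW.
  apply: le_trans (support_line w (mA _) le_x nle_x).
  rewrite lerD2l ler_wpM2r ?subr_ge0// (le_trans c2)//.
  by rewrite leb01_quantile; last exact: measurable_itv.
- have lt_x t : (quantile nu @^-1` `]-oo, x[) t -> quantile nu t <= x.
    by rewrite /= in_itv/= => /ltW.
  have nlt_x t : ~ (quantile nu @^-1` `]-oo, x[) t -> x <= quantile nu t.
    by rewrite /= in_itv/= => /negP; rewrite -leNgt.
  apply: le_trans (support_line w (mA _) lt_x nlt_x).
  rewrite lerD2l ler_wnM2r ?subr_le0// (le_trans _ c1)//.
  by rewrite leb01_quantile; last exact: measurable_itv.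
Qed.

Lemma mean_dist_lipschitz x w : mean_dist x <= mean_dist w + `|x - w|.
Proof.
rewrite -[X in _ <= _ + X]Rintegral01_cst.
rewrite -(RintegralD measurableT (dist_L1 w) (L1_cst _)).
apply: le_Rintegral; [by []|exact: dist_L1|exact: L1D (dist_L1 w) (L1_cst _)|].
by move=> t _; rewrite [leRHS]addrC; exact: ler_distD.
Qed.

(** Being 1-Lipschitz, the function becomes monotone when x is added. *)
Lemma measurable_mean_dist : measurable_fun [set: R] mean_dist.
Proof.
rewrite (_ : mean_dist = (fun x => (mean_dist x + x) - x)); last first.
  by apply/funext => x; rewrite addrK.
apply: measurable_funB => //.
apply: nondecreasing_measurable => // x w xw.
have := mean_dist_lipschitz x w; rewrite distrC ger0_norm ?subr_ge0//; lra.
Qed.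

Lemma mean_dist_ge0 x : 0 <= mean_dist x.
Proof. exact: Rintegral_ge0. Qed.

Definition energy_density u s : R := (1 - 2 * s) * u s + mean_dist (u s).

Lemma F_E u : F_ nu u = \int[leb01]_s energy_density u s.
Proof. by []. Qed.

Lemma energy_density_L1 u : L2 u -> L1 (energy_density u).
Proof.
move=> Lu; have mu_ := L2_measurable Lu; apply: L1D.
- apply: L2M_L1 => //; apply/L2P; split.
    apply: measurable_funB; first exact: measurable_cst.
    by apply: measurable_funM; [exact: measurable_cst|exact: measurable_id].
  apply: (@le_lt_trans _ _ (\int[@leb01 R]_s 1%:E)%E); last by rewrite integral01_cst ltry.
  apply: ae_ge0_le_integral => //.
  + by move=> s _; rewrite lee_fin sqr_ge0.
  + apply/measurable_EFinP; apply: measurable_funX.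
    apply: measurable_funB; first exact: measurable_cst.
    by apply: measurable_funM; [exact: measurable_cst|exact: measurable_id].
  + apply: (ae01_cocountable (mu := nu) (countable0 _)).
    move=> s [/andP[s0 s1] _] _ _; rewrite lee_fin; nra.
- have mm : measurable_fun [set: R] (mean_dist \o u).
    by apply: measurableT_comp => //; exact: measurable_mean_dist.
  have la : L1 (fun s => `|u s| + mean_dist 0).
    by apply: L1D; [exact: L1_norm (L2_L1 Lu)|exact: L1_cst].
  apply: le_integrable la => //; first by apply/measurable_EFinP.
  move=> s _; rewrite lee_fin ger0_norm ?mean_dist_ge0//.
  rewrite [leRHS]ger0_norm ?addr_ge0 ?mean_dist_ge0// addrC.
  by have := mean_dist_lipschitz (u s) 0; rewrite subr0.
Qed.

(** The bounds are the one-sided derivatives of the energy density, which is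
    convex in the value u s; integrating the supporting lines gives a subgradient
    with no remainder. *)
Lemma subdifferential_F_ u xi : L2 u -> L2 xi ->
  {ae leb01, forall s, 2 * (Rminus nu (u s) - s) <= xi s <=
    2 * (Rplus nu (u s) - s)} ->
  subdifferential (F_ nu) u xi.
Proof.
move=> Lu Lxi uxi; split=> // e e0; exists 1 => // w Lw _.
have Lwu := L2B Lw Lu.
apply: (@le_trans _ _ (F_ nu u + innerL2 xi (w - u))).
  by rewrite gerBl mulr_ge0 ?normL2_ge0// ltW.
rewrite !F_E /innerL2.
have lx := L2M_L1 Lxi Lwu; have lu := energy_density_L1 Lu.
rewrite -(RintegralD measurableT lu lx); apply: ae_le_Rintegral01.
- exact: L1D.
- exact: energy_density_L1.
- apply: (@filterS _ _ (ae_filter_ringOfSetsType leb01) _ _ _ uxi) => s /andP[h1 h2].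
  have := @mean_dist_subgradient (u s) (w s) (xi s + 2 * s - 1).
  move=> /(_ ltac:(apply/andP; split; lra)).
  rewrite /energy_density !fctE; lra.
Qed.

End energy.

(** * The flow as a curve in L_2(0,1) *)

Section flow_curve.
Context {R : realType}.
Variables mu0 nu : probability (measurableTypeR R) R.
Implicit Types s t : R.
Hypothesis hnu : finite_second_moment nu.
Hypothesis hmu0 : finite_second_moment mu0.
Variable Rnu : R -> R.
Hypothesis hRnu : Rnu = Rplus nu \/ Rnu = Rminus nu.

Let D := quantile_continuity_points nu.
Let g := flow mu0 nu Rnu.

Let gE s t : D s -> g t s = flow_at mu0 nu Rnu s t.
Proof. by move=> Ds; rewrite /g /flow patchE mem_set. Qed.

Let gN s t : ~ D s -> g t s = 0.
Proof. by move=> Ds; rewrite /g /flow patchE memNset. Qed.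

Let mD : measurable (D : set (measurableTypeR R)).
Proof. exact: measurable_continuity_points. Qed.

Definition flow_velocity (t : R) : R -> R :=
  (fun s => 2 * velocity nu Rnu s (flow mu0 nu Rnu t s)) \_ D.

Let vE s t : D s -> flow_velocity t s = 2 * velocity nu Rnu s (g t s).
Proof. by move=> Ds; rewrite /flow_velocity patchE mem_set. Qed.

Lemma measurable_flow t : 0 <= t -> measurable_fun [set: R] (g t).
Proof.
move=> t0; apply/(measurable_restrictT _ mD); apply: monotone_measurable => //.
by move=> s1 s2 D1 D2 s12; exact: flow_at_nd.
Qed.

Lemma measurable_flow_velocity t : 0 <= t ->
  measurable_fun [set: R] (flow_velocity t).
Proof.
move=> t0; apply/(measurable_restrictT _ mD); apply: measurable_funTS.
apply: measurable_funM; first exact: measurable_cst.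
rewrite /velocity; apply: measurable_fun_ifT.
- by apply: measurable_fun_eqr; [exact: measurable_flow|exact: measurable_quantile].
- exact: measurable_cst.
- apply: measurable_funB => //; apply: measurableT_comp; last exact: measurable_flow.
  by apply: nondecreasing_measurable => // x y; exact: (Rnu_nd hRnu).
Qed.

Lemma flow_velocity_le t s : `|flow_velocity t s| <= 2.
Proof.
rewrite /flow_velocity patchE; case: ifPn => [|_]; last by rewrite normr0.
rewrite inE => Ds; rewrite normrM ger0_norm// ler_piMr//.
exact: velocity_le1.
Qed.

Lemma flow_lipschitz t t' s : 0 <= t -> 0 <= t' ->
  `|g t s - g t' s| <= 2 * `|t - t'|.
Proof.
move=> t0 t'0; have [Ds|nDs] := pselect (D s).
  by rewrite !gE//; exact: flow_at_lipschitz.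
by rewrite !gN// subrr normr0 mulr_ge0.
Qed.

Lemma flow_bounded t s : 0 <= t ->
  `|g t s| <= `|quantile mu0 s| + `|quantile nu s|.
Proof.
move=> t0; have [Ds|nDs] := pselect (D s); last by rewrite gN// normr0 addr_ge0.
have := flow_at_toward mu0 hRnu Ds t0; rewrite gE//.
have := ler_norm (quantile mu0 s); have := ler_norm (quantile nu s).
have := ler_norm (- quantile mu0 s); have := ler_norm (- quantile nu s).
rewrite !normrN => h1 h2 h3 h4.
have := normr_ge0 (quantile mu0 s); have := normr_ge0 (quantile nu s) => h5 h6.
by rewrite ler_norml => /orP[] /andP[l u]; apply/andP; split; lra.
Qed.

Lemma flow_bound_L2 : L2 (fun s => `|quantile mu0 s| + `|quantile nu s|).
Proof. by apply: L2D; apply: L2_abs; exact: quantile_L2. Qed.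

Lemma flow_is_derive (t : R) : 0 < t -> {ae leb01, forall s,
  is_derive t 1 (fun r => g r s) (flow_velocity t s)}.
Proof.
move=> t0; apply: (ae01_cocountable (countable_atom_passing mu0 hRnu t0)).
move=> s Ds nB; rewrite (vE t Ds) (gE t Ds).
rewrite (_ : (fun r => g r s) = flow_at mu0 nu Rnu s); last first.
  by apply/funext => r; exact: gE r Ds.
apply: (flow_at_derive hRnu Ds t0).
set x := flow_at mu0 nu Rnu s t.
have [/eqP ?|ne] := boolP (Rminus nu x == Rplus nu x); [by left|right].
by apply/eqP => T; apply: nB; split; [exact: Ds|exact: ne|exact: T].
Qed.

Lemma flow_velocity_subdifferential t : 0 <= t ->
  subdifferential (F_ nu) (g t) (- flow_velocity t).
Proof.
move=> t0.
have Lg : L2 (g t).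
  apply: L2_dom (measurable_flow t0) flow_bound_L2 _ => s.
  by rewrite [leRHS]ger0_norm ?addr_ge0// flow_bounded.
have Lv : L2 (flow_velocity t).
  exact: L2_bounded (measurable_flow_velocity t0) (flow_velocity_le t).
apply: subdifferential_F_ => //; first exact: L2N.
apply: (ae01_cocountable (mu := nu) (countable0 _)) => s Ds _.
rewrite !fctE (vE t Ds) /velocity.
have s01 := continuity_point01 Ds.
case: eqP => [->|_].
  have := Rminus_quantile nu s01; have := Rplus_quantile nu s01.
  by move=> h1 h2; apply/andP; split; lra.
have := Rnu_ge hRnu (g t s); have := Rnu_le hRnu (g t s).
by move=> h1 h2; apply/andP; split; lra.
Qed.

End flow_curve.

Theorem theorem5p2 (R : realType)
    (nu mu0 : probability (measurableTypeR R) R)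
    (hnu : finite_second_moment nu) (hmu0 : finite_second_moment mu0)
    (Rnu : R -> R) (hRnu : Rnu = Rplus nu \/ Rnu = Rminus nu) :
  strong_solution (F_ nu) (quantile mu0) (flow mu0 nu Rnu).
Proof.
have mg t := measurable_flow mu0 hRnu (t := t).
have LG := flow_bound_L2 hnu hmu0.
have gG t s := flow_bounded mu0 hRnu (t := t) s.
have gL t t' s := flow_lipschitz mu0 hRnu (t := t) (t' := t') s.
have mv t (t0 : 0 < t) := measurable_flow_velocity mu0 hRnu (ltW t0).
have vL t s (_ : 0 < t) := flow_velocity_le mu0 hRnu t s.
have gv t := flow_is_derive mu0 hRnu (t := t).
have two : (0 : R) <= 2 by [].
split.
- by move=> T T0; exact: (curve_W11 two mg LG gG gL mv vL gv).
- exact: (curve_continuousL2 two mg LG gG gL).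
- apply: (ae01_cocountable (mu := nu) (countable0 _)) => s Ds _.
  by rewrite /flow patchE mem_set//; exact: flow_at0.
- apply: aeW => t t0; exists (flow_velocity mu0 nu Rnu t).
    exact: (curve_strong_derivative two mg gL mv vL gv).
  by apply: flow_velocity_subdifferential => //; exact: ltW.
Qed.
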